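(* Let $X$ be a real-valued Lévy process without killing, with characteristic exponent $\psi\colon\mathbb{R}\to\mathbb{C}$, i.e. $\mathbb{E}[e^{\mathrm{i}zX_t}]=e^{-t\psi(z)}$ for $z\in\mathbb{R}$, $t\ge 0$. Let $\kappa_+,\kappa_-,\kappa'_+,\kappa'_-$ be functions on $\mathbb{C}_u=\{z\in\mathbb{C}:\operatorname{Im} z\ge 0\}$, each of which is the characteristic exponent of some (possibly killed) subordinator, and suppose that $$\psi(z)=\kappa_+(z)\,\kappa_-(-z)=\kappa'_+(z)\,\kappa'_-(-z),\qquad z\in\mathbb{R}.$$ Then there exists some $c>0$ such that $$\kappa_+(z)=c\,\kappa'_+(z)\quad\text{and}\quad \kappa'_-(z)=c\,\kappa_-(z)\qquad\text{for all } z\in\mathbb{C}_u.$$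
   Context: A function $\kappa\colon\mathbb{C}_u\to\mathbb{C}$, where $\mathbb{C}_u=\{z\in\mathbb{C}:\operatorname{Im}z\ge0\}$, is the characteristic exponent of a (possibly killed) subordinator if $$-\kappa(z)=-q+\mathrm{i}dz+\int_{(0,\infty)}(e^{\mathrm{i}xz}-1)\,\mu(\mathrm{d}x),\qquad \operatorname{Im}z\ge 0,$$ where $q\ge0$ (killing rate), $d\ge0$ (drift), and $\mu$ (Lévy measure) is a measure on $(0,\infty)$ with $\int_{(0,\infty)}(1\wedge x)\,\mu(\mathrm{d}x)<\infty$. Equivalently, $\lambda\mapsto\kappa(\mathrm{i}\lambda)$ is a Bernstein function.
   Formalization: It is additionally assumed that ψ is not identically zero (X is not the zero process); for X = 0 the claim fails, e.g. κ₊ = κ'₊ = 0, κ₋ = 1, κ'₋(z) = −iz. *)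

(* Defs.v *)
From HB Require Import structures.
From mathcomp Require Export all_boot all_order all_algebra.
From mathcomp Require Export all_classical all_reals all_analysis.
From mathcomp Require Export complex.

Set Implicit Arguments.
Unset Strict Implicit.
Unset Printing Implicit Defensive.

Import Order.TTheory GRing.Theory Num.Theory.
Import numFieldTopology.Exports numFieldNormedType.Exports.

Local Open Scope classical_set_scope.
Local Open Scope ring_scope.
Local Open Scope complex_scope.

Definition cexp (R : realType) (z : R[i]) : R[i] :=
  (expR (complex.Re z) * cos (complex.Im z))
    +i* (expR (complex.Re z) * sin (complex.Im z)).

(* [Rintegral] is total, but the integrands used below have integrable real
   and imaginary parts: |exp(izX)| = 1, and |exp(ixz) - 1| <= min(2, |z| x)
   for x > 0 and Im z >= 0. *)
Definition cintegral (d : measure_display) (T : measurableType d)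
    (R : realType) (mu : {measure set T -> \bar R}) (D : set T)
    (f : T -> R[i]) : R[i] :=
  (\int[mu]_(x in D) complex.Re (f x))
    +i* (\int[mu]_(x in D) complex.Im (f x)).

(* Mutual independence; subfamilies are covered by taking [B i := setT]. *)
Definition independent_RVs (d : measure_display) (Omega : measurableType d)
    (R : realType) (P : probability Omega R) (n : nat)
    (Y : 'I_n -> Omega -> R) : Prop :=
  forall B : 'I_n -> set R, (forall i, measurable (B i)) ->
  P (\bigcap_(i in [set: 'I_n]) (Y i @^-1` B i))
  = (\prod_(i < n) P (Y i @^-1` B i))%E.

Definition cadlag (R : realType) (f : R -> R) : Prop :=
  (forall t, 0 <= t -> f x @[x --> t^'+] --> f t) /\
  (forall t, 0 < t -> cvg (f x @[x --> t^'-])).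

(* The time set is [0, +oo[: the values [X t] for t < 0 are never used.  There
   is no killing, since every [X t] takes values in R on all of Omega. *)
Record levy_process (d : measure_display) (Omega : measurableType d)
    (R : realType) (P : probability Omega R) (X : R -> {RV P >-> R}) : Prop :=
  LevyProcess {
    levy_start : {ae P, forall w, X 0 w = 0};
    levy_independent_increments :
      forall (n : nat) (t : nat -> R),
        0 <= t 0%N -> (forall i, (i < n)%N -> t i <= t i.+1) ->
        independent_RVs P (fun (i : 'I_n) w => X (t i.+1) w - X (t i) w);
    levy_stationary_increments :
      forall s t : R, 0 <= s -> 0 <= t ->
        forall B : set R, measurable B ->
        P [set w | B (X (s + t) w - X s w)] = P [set w | B (X t w)];
    levy_cadlag : {ae P, forall w, cadlag (fun t => X t w)}
  }.

Definition is_levy_exponent (d : measure_display) (Omega : measurableType d)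
    (R : realType) (P : probability Omega R) (X : R -> {RV P >-> R})
    (psi : R -> R[i]) : Prop :=
  forall t z : R, 0 <= t ->
    cintegral P [set: Omega] (fun w => cexp ('i%C * (z * X t w)%:C))
    = cexp (- (t%:C * psi z)).

(* A function on the closed upper half-plane is represented by a function on
   R[i] whose values at points with negative imaginary part are ignored; a
   measure on ]0, +oo[ by a Borel measure on R that is only integrated over
   ]0, +oo[. *)
Definition is_subordinator_exponent (R : realType) (kappa : R[i] -> R[i]) : Prop :=
  exists (q delta : R) (mu : {measure set R -> \bar R}),
    [/\ 0 <= q, 0 <= delta,
        (\int[mu]_(x in `]0%R, +oo[) (Num.min 1 x)%:E < +oo)%E &
        forall z : R[i], 0 <= complex.Im z ->
          - kappa z = - q%:C + 'i%C * delta%:C * z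
            + cintegral mu `]0, +oo[ (fun x => cexp ('i%C * x%:C * z) - 1)].

(* Main.v *)
Require Import Defs.
From mathcomp Require Import ring lra measurable_realfun.
Import Order.TTheory GRing.Theory Num.Theory.
Import numFieldNormedType.Exports.
Local Open Scope classical_set_scope.
Local Open Scope ring_scope.
Local Open Scope complex_scope.

Set Implicit Arguments.
Unset Strict Implicit.
Unset Printing Implicit Defensive.

(** The classical idea is that F = kp / kp' on the upper half-plane and
z |-> km' (- z) / km (- z) on the lower one agree on the real line, so that
they glue to an entire function, and a Liouville argument should make it
constant. Two things go wrong with F itself: it is unbounded, and it may have
poles at the real zeros of psi, of which there are infinitely many when the
process lives on a lattice. Both disappear after one change of variable.
Every subordinator exponent has nonnegative real part, so F omits the negative
half-line, its principal square root s / s' (with s, s' the square roots of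
kp, kp') has nonnegative real part, and

   f = (s - s') / (s + s')

is bounded by 1. Let g be the same function formed with (km', km).

On the real line g is the conjugate of f ([boundary_conj]). Indeed
s (x) * t (- x) and s' (x) * t' (- x), where t, t' are the square roots of km,
km', are square roots with nonnegative real part of psi (x), and they agree
because Re psi is nonnegative ([csqrt_factor], [Re_levy_exponent_ge0]). The
zeros of the exponents, where f and g may be discontinuous, are only countably
many ([countable_levy_exp_zeros]).

Map the unit disc onto the upper half-plane with 0 going to an arbitrary point
a. The mean of a holomorphic function over the circles of radius r < 1 is its
value at a ([mean_value]); letting r tend to 1, dominated convergence yields
that g (a) is the conjugate of f (a) ([interior_conj]). A holomorphic function
whose conjugate is holomorphic is constant ([sqrt_cayley_const]). Hence s / s'
and t' / t are constant on the upper half-plane, with a common value, which is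
positive because it is so on the imaginary axis ([factorization_unique]);
squaring and passing to the closed half-plane by continuity gives the theorem.

Holomorphy is handled through real curves: a function is holomorphic when it
satisfies the complex chain rule along them. For exponents this is
differentiation under the integral sign ([holomorphic_levy_exp]), and sums,
products, quotients and square roots inherit it. *)

(** * Complex numbers by real and imaginary parts *)

Section complex_parts.
Variable R : realType.
Implicit Types z u : R[i].
Local Notation Re := complex.Re.
Local Notation Im := complex.Im.
Local Notation normc := ComplexField.Normc.normc.

Lemma ReD z u : Re (z + u) = Re z + Re u. Proof. by case: z; case: u. Qed.
Lemma ImD z u : Im (z + u) = Im z + Im u. Proof. by case: z; case: u. Qed.
Lemma ReN z : Re (- z) = - Re z. Proof. by case: z. Qed.
Lemma ImN z : Im (- z) = - Im z. Proof. by case: z. Qed.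
Lemma ReM z u : Re (z * u) = Re z * Re u - Im z * Im u.
Proof. by case: z; case: u. Qed.
Lemma ImM z u : Im (z * u) = Re z * Im u + Im z * Re u.
Proof. by case: z; case: u. Qed.
Lemma ReV z : Re z^-1 = Re z / (Re z ^+ 2 + Im z ^+ 2).
Proof. by case: z. Qed.
Lemma ImV z : Im z^-1 = - (Im z / (Re z ^+ 2 + Im z ^+ 2)).
Proof. by case: z => a b /=; rewrite -?mulNr. Qed.
Lemma ReJ z : Re (z^*) = Re z. Proof. by case: z. Qed.
Lemma ImJ z : Im (z^*) = - Im z. Proof. by case: z. Qed.

Lemma complexP z u : Re z = Re u -> Im z = Im u -> z = u.
Proof. by case: z => a b; case: u => c d /= -> ->. Qed.

Lemma sqmod_gt0 z : z != 0 -> 0 < Re z ^+ 2 + Im z ^+ 2.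
Proof.
case: z => a b; rewrite eq_complex /= negb_and => ab.
rewrite lt_neqAle addr_ge0 ?sqr_ge0// andbT eq_sym paddr_eq0 ?sqr_ge0//.
by rewrite !sqrf_eq0 negb_and.
Qed.

Lemma normcE_parts z : normc z = Num.sqrt (Re z ^+ 2 + Im z ^+ 2).
Proof. by case: z. Qed.

Lemma normc_ge0 z : 0 <= normc z.
Proof. by rewrite normcE_parts sqrtr_ge0. Qed.

Lemma normc_sqr z : normc z ^+ 2 = Re z ^+ 2 + Im z ^+ 2.
Proof. by rewrite normcE_parts sqr_sqrtr// addr_ge0// sqr_ge0. Qed.

Lemma Re_le_normc z : `|Re z| <= normc z.
Proof. by rewrite normcE_parts -sqrtr_sqr ler_wsqrtr// lerDl sqr_ge0. Qed.

Lemma Im_le_normc z : `|Im z| <= normc z.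
Proof. by rewrite normcE_parts -sqrtr_sqr ler_wsqrtr// lerDr sqr_ge0. Qed.

Lemma normc_leD z : normc z <= `|Re z| + `|Im z|.
Proof.
rewrite normcE_parts -[leRHS]ger0_norm ?addr_ge0// -sqrtr_sqr ler_wsqrtr//.
rewrite sqrrD !real_normK ?num_real// addrAC lerDl.
by rewrite mulrn_wge0// mulr_ge0.
Qed.

Lemma normc_gt0 z : z != 0 -> 0 < normc z.
Proof. by move=> /sqmod_gt0; rewrite normcE_parts sqrtr_gt0. Qed.

End complex_parts.

Section real_derivatives.
Variable R : realType.
Implicit Types (f g : R -> R) (t a b : R).

Lemma derD f g t a b : is_derive t 1 f a -> is_derive t 1 g b ->
  is_derive t 1 (fun s => f s + g s) (a + b).
Proof. by move=> fa gb; exact: is_deriveD. Qed.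

Lemma derN f t a : is_derive t 1 f a -> is_derive t 1 (fun s => - f s) (- a).
Proof. by move=> fa; exact: is_deriveN. Qed.

Lemma derM f g t a b : is_derive t 1 f a -> is_derive t 1 g b ->
  is_derive t 1 (fun s => f s * g s) (a * g t + f t * b).
Proof.
move=> fa gb; apply: (is_derive_eq (is_deriveM fa gb)).
by rewrite addrC /GRing.scale/= mulrC.
Qed.

Lemma derV f t a : f t != 0 -> is_derive t 1 f a ->
  is_derive t 1 (fun s => (f s)^-1) (- (a / f t ^+ 2)).
Proof.
move=> ft0 fa; apply: (is_derive_eq (is_deriveV ft0 fa)).
by rewrite /GRing.scale/= mulNr mulrC.
Qed.

Lemma dercst c t : is_derive t 1 (fun=> c : R) (0 : R).
Proof. exact: is_derive_cst. Qed.

Lemma derid t : is_derive t 1 (fun s : R => s) (1 : R).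
Proof. exact: is_derive_id. Qed.

Lemma dersqrt f t a : 0 < f t -> is_derive t 1 f a ->
  is_derive t 1 (fun s => Num.sqrt (f s)) ((2 * Num.sqrt (f t))^-1 * a).
Proof. by move=> ft0 fa; apply: (is_derive1_comp (is_derive1_sqrt ft0) fa). Qed.

Lemma derexp f t a : is_derive t 1 f a ->
  is_derive t 1 (fun s => expR (f s)) (expR (f t) * a).
Proof. by move=> fa; apply: (is_derive1_comp (is_derive_expR (f t)) fa). Qed.

Lemma dercos f t a : is_derive t 1 f a ->
  is_derive t 1 (fun s => cos (f s)) (- sin (f t) * a).
Proof. by move=> fa; apply: (is_derive1_comp (is_derive_cos (f t)) fa). Qed.

Lemma dersin f t a : is_derive t 1 f a ->
  is_derive t 1 (fun s => sin (f s)) (cos (f t) * a).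
Proof. by move=> fa; apply: (is_derive1_comp (is_derive_sin (f t)) fa). Qed.

Lemma der_cvg f t a : is_derive t 1 f a -> f x @[x --> t] --> f t.
Proof.
move=> [/derivable1_diffP/differentiable_continuous fc _].
exact: fc.
Qed.

End real_derivatives.

Section complex_calculus.
Variable R : realType.
Local Notation Re := complex.Re.
Local Notation Im := complex.Im.
Local Notation normc := ComplexField.Normc.normc.

(** Limits and derivatives of complex valued functions are taken
componentwise, so that the real calculus applies unchanged; only curves, that
is functions of one real parameter, are ever differentiated. *)
Definition ccvg (T : Type) (F : set_system T) (f : T -> R[i]) (l : R[i]) :=
  Re (f t) @[t --> F] --> Re l /\ Im (f t) @[t --> F] --> Im l.

Definition cder (f : R -> R[i]) (t : R) (l : R[i]) :=
  is_derive t 1 (fun s => Re (f s)) (Re l) /\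
  is_derive t 1 (fun s => Im (f s)) (Im l).

Section limits.
Context {T : Type} {F : set_system T} {FF : Filter F}.
Implicit Types (f g : T -> R[i]) (k l : R[i]).

Lemma ccvg_cst k : ccvg F (fun=> k) k.
Proof. by split; exact: cvg_cst. Qed.

Lemma ccvgD f g k l : ccvg F f k -> ccvg F g l ->
  ccvg F (fun t => f t + g t) (k + l).
Proof.
move=> [f1 f2] [g1 g2]; split; rewrite ?ReD ?ImD.
- by under eq_fun do rewrite ReD; exact: cvgD.
- by under eq_fun do rewrite ImD; exact: cvgD.
Qed.

Lemma ccvgN f k : ccvg F f k -> ccvg F (fun t => - f t) (- k).
Proof.
move=> [f1 f2]; split; rewrite ?ReN ?ImN.
- by under eq_fun do rewrite ReN; exact: cvgN.
- by under eq_fun do rewrite ImN; exact: cvgN.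
Qed.

Lemma ccvgB f g k l : ccvg F f k -> ccvg F g l ->
  ccvg F (fun t => f t - g t) (k - l).
Proof. by move=> fk gl; exact/ccvgD/ccvgN. Qed.

Lemma ccvgM f g k l : ccvg F f k -> ccvg F g l ->
  ccvg F (fun t => f t * g t) (k * l).
Proof.
move=> [f1 f2] [g1 g2]; split; rewrite ?ReM ?ImM.
- by under eq_fun do rewrite ReM; apply: cvgB; exact: cvgM.
- by under eq_fun do rewrite ImM; apply: cvgD; exact: cvgM.
Qed.

Lemma cvg_sqmod f k : ccvg F f k ->
  (Re (f t) ^+ 2 + Im (f t) ^+ 2) @[t --> F] --> Re k ^+ 2 + Im k ^+ 2.
Proof. by move=> [f1 f2]; apply: cvgD; rewrite !expr2; apply: cvgM. Qed.

Lemma ccvgV f k : k != 0 -> ccvg F f k -> ccvg F (fun t => (f t)^-1) k^-1.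
Proof.
move=> k0 fk; have m0 := lt0r_neq0 (sqmod_gt0 k0); have fm := cvg_sqmod fk.
case: fk => f1 f2; split; rewrite ?ReV ?ImV.
- by under eq_fun do rewrite ReV; apply: cvgM => //; exact: cvgV.
- under eq_fun do rewrite ImV; apply: cvgN; apply: cvgM => //; exact: cvgV.
Qed.

End limits.

Section derivatives.
Implicit Types (f g : R -> R[i]) (t : R) (k l : R[i]).

Lemma cder_cst k t : cder (fun=> k) t 0.
Proof. by split; exact: dercst. Qed.

Lemma cder_eq f t k l : cder f t k -> k = l -> cder f t l.
Proof. by move=> ? <-. Qed.

Lemma cder_unique f t k l : cder f t k -> cder f t l -> k = l.
Proof.
by move=> [[_ f1] [_ f2]] [[_ g1] [_ g2]]; apply: complexP; rewrite -?f1 -?f2.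
Qed.

Lemma cder_near_eq f g t k : (\near t, f t = g t) -> cder f t k -> cder g t k.
Proof.
move=> fg [f1 f2]; split.
- apply: near_eq_is_derive f1; apply: filterS fg => s; exact: congr1.
- apply: near_eq_is_derive f2; apply: filterS fg => s; exact: congr1.
Qed.

Lemma cderD f g t k l : cder f t k -> cder g t l ->
  cder (fun s => f s + g s) t (k + l).
Proof.
move=> [f1 f2] [g1 g2]; split; rewrite ?ReD ?ImD.
- by under eq_fun do rewrite ReD; exact: derD.
- by under eq_fun do rewrite ImD; exact: derD.
Qed.

Lemma cderN f t k : cder f t k -> cder (fun s => - f s) t (- k).
Proof.
move=> [f1 f2]; split; rewrite ?ReN ?ImN.
- by under eq_fun do rewrite ReN; exact: derN.
- by under eq_fun do rewrite ImN; exact: derN.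
Qed.

Lemma cderB f g t k l : cder f t k -> cder g t l ->
  cder (fun s => f s - g s) t (k - l).
Proof. by move=> fk gl; exact/cderD/cderN. Qed.

Lemma cderM f g t k l : cder f t k -> cder g t l ->
  cder (fun s => f s * g s) t (k * g t + f t * l).
Proof.
move=> [f1 f2] [g1 g2]; split.
- under eq_fun do rewrite ReM.
  apply: (is_derive_eq (derD (derM f1 g1) (derN (derM f2 g2)))).
  by rewrite ReD !ReM; ring.
- under eq_fun do rewrite ImM.
  apply: (is_derive_eq (derD (derM f1 g2) (derM f2 g1))).
  by rewrite ImD !ImM; ring.
Qed.

Lemma cder_cvg f t k : cder f t k -> ccvg (nbhs t) f (f t).
Proof. by move=> [f1 f2]; split; [exact: (der_cvg f1)|exact: (der_cvg f2)]. Qed.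

Lemma cderV f t k : f t != 0 -> cder f t k ->
  cder (fun s => (f s)^-1) t (- (k / f t ^+ 2)).
Proof.
move=> k0 [f1 f2].
have m0 := lt0r_neq0 (sqmod_gt0 k0).

have m0' : Re (f t) * Re (f t) + Im (f t) * Im (f t) != 0 by rewrite -!expr2.
have dV := @derV _ (fun s => Re (f s) * Re (f s) + Im (f s) * Im (f s)) _ _ m0'
  (derD (derM f1 f1) (derM f2 f2)).
split.
- under eq_fun do rewrite ReV !expr2.
  apply: (is_derive_eq (derM f1 dV)).
  rewrite ReN ReM ReV ImV expr2 !ReM !ImM; field.
  rewrite m0' andbT.
  have := sqmod_gt0 (mulf_neq0 k0 k0); rewrite ReM ImM => /lt0r_neq0.
  by rewrite !expr2.
- under eq_fun do rewrite ImV !expr2.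
  apply: (is_derive_eq (derN (derM f2 dV))).
  rewrite ImN ImM ReV ImV expr2 !ReM !ImM; field.
  rewrite m0' andbT.
  have := sqmod_gt0 (mulf_neq0 k0 k0); rewrite ReM ImM => /lt0r_neq0.
  by rewrite !expr2.
Qed.

End derivatives.
End complex_calculus.

(** * The principal square root *)

Section square_root.
Variable R : realType.
Local Notation Re := complex.Re.
Local Notation Im := complex.Im.
Local Notation normc := ComplexField.Normc.normc.
Implicit Types z : R[i].

(** The principal square root. With m = |z|, its real part is sqrt((m + Re z)/2)
and twice the product of its two parts is Im z; solving for the imaginary part
gives a formula without case distinction on the sign of Im z, hence smooth off
the negative half-line. At 0 the convention 0 / 0 = 0 gives the right value. *)
Definition csqrt z : R[i] :=
  let p := Num.sqrt (2 * (Num.sqrt (Re z ^+ 2 + Im z ^+ 2) + Re z)) in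
  (p / 2) +i* (Im z / p).

Lemma normcDRe_gt0 z : 0 <= Re z -> z != 0 ->
  0 < 2 * (Num.sqrt (Re z ^+ 2 + Im z ^+ 2) + Re z).
Proof.
move=> z0 zn0; rewrite mulr_gt0// ltr_wpDr// -normcE_parts.
exact: normc_gt0.
Qed.

Lemma csqrt0 : csqrt 0 = 0.
Proof. by apply: complexP;
  rewrite /csqrt/= ?mul0r// expr0n/= !addr0 sqrtr0 mulr0 sqrtr0 mul0r. Qed.

Lemma csqrtK z : 0 <= Re z -> csqrt z ^+ 2 = z.
Proof.
have [->|zn0] := eqVneq z 0; first by rewrite csqrt0 expr0n.
move=> z0; have := normcDRe_gt0 z0 zn0.
rewrite /csqrt -normcE_parts; set p := Num.sqrt _ => p0.
have p2 : p ^+ 2 = 2 * (normc z + Re z) by rewrite sqr_sqrtr// ltW.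
have pn0 : p != 0 by rewrite lt0r_neq0// sqrtr_gt0.
have n2 := normc_sqr z.
have nz : normc z + Re z != 0.
  by apply: lt0r_neq0; move: p0; rewrite pmulr_rgt0.
apply: complexP; rewrite expr2 ?ReM ?ImM/=; last by field.
rewrite -!expr2 !exprMn !exprVn p2.
have -> : Im z ^+ 2 = (normc z - Re z) * (normc z + Re z).
  by rewrite mulrDr !mulrBl -!expr2 n2; ring.
by field.
Qed.

Lemma Re_csqrt_ge0 z : 0 <= Re (csqrt z).
Proof. by rewrite /csqrt/= divr_ge0// sqrtr_ge0. Qed.

(** Re (s ^ 2) = (Re s) ^ 2 - (Im s) ^ 2, so a square root of a point of the
right half-plane lies in the sector of half-angle pi / 4. *)
Lemma csqrt_sector z : 0 <= Re z -> `|Im (csqrt z)| <= Re (csqrt z).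
Proof.
move=> z0; rewrite -[leRHS]ger0_norm ?Re_csqrt_ge0// -ler_sqr ?nnegrE//.
rewrite !real_normK ?num_real// -subr_ge0.
by have := csqrtK z0 => /(congr1 (@complex.Re R)); rewrite expr2 ReM -!expr2 => ->.
Qed.

Lemma csqrtJ z : csqrt (z^*) = (csqrt z)^*.
Proof. by case: z => a b; rewrite /csqrt/= sqrrN mulNr. Qed.

Lemma csqrt_eq0 z : 0 <= Re z -> (csqrt z == 0) = (z == 0).
Proof.
move=> z0; apply/eqP/eqP => [s0|->]; last exact: csqrt0.
by rewrite -(csqrtK z0) s0 expr0n.
Qed.

Lemma ccvg_csqrt T (F : set_system T) {FF : Filter F} (f : T -> R[i]) z :
  0 <= Re z -> z != 0 -> ccvg F f z -> ccvg F (fun t => csqrt (f t)) (csqrt z).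
Proof.
move=> z0 zn0 fz.
have p0 := normcDRe_gt0 z0 zn0.
have pc : Num.sqrt (2 * (Num.sqrt (Re (f t) ^+ 2 + Im (f t) ^+ 2) + Re (f t)))
  @[t --> F] --> Num.sqrt (2 * (Num.sqrt (Re z ^+ 2 + Im z ^+ 2) + Re z)).
  apply: continuous_cvg; first exact: sqrt_continuous.
  apply: cvgMr; apply: cvgD; last exact: fz.1.
  apply: continuous_cvg; first exact: sqrt_continuous.
  exact: cvg_sqmod.
split; rewrite /csqrt/=; apply: cvgM => //.
- exact: cvg_cst.
- exact: fz.2.
- by apply: cvgV => //; rewrite lt0r_neq0// sqrtr_gt0.
Qed.

(** It suffices to know that some derivative l exists, which the explicit
formula gives; differentiating s * s = z then forces 2 * s * l = z'. *)
Lemma cder_csqrt (f : R -> R[i]) t k : (\forall s \near t, 0 <= Re (f s)) ->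
  f t != 0 -> cder f t k ->
  cder (fun s => csqrt (f s)) t (k / (2 * csqrt (f t))).
Proof.
move=> fge ft0 fk; have ft : 0 <= Re (f t) by exact: (nbhs_singleton fge).
have p0 := normcDRe_gt0 ft ft0.
have m0 := sqmod_gt0 ft0.
have [l hl] : exists l, cder (fun s => csqrt (f s)) t l.
  case: fk => f1 f2; rewrite /csqrt.
  have m0' : 0 < Re (f t) * Re (f t) + Im (f t) * Im (f t) by rewrite -!expr2.
  have dm := @dersqrt _ (fun s => Re (f s) * Re (f s) + Im (f s) * Im (f s))
    _ _ m0' (derD (derM f1 f1) (derM f2 f2)).
  have p0' : 0 < 2 * (Num.sqrt (Re (f t) * Re (f t) + Im (f t) * Im (f t)) + Re
    (f t)).
    by rewrite -!expr2.
  have dp := @dersqrt _ (fun s => 2 * (Num.sqrt (Re (f s) * Re (f s) + Im (f s)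
    * Im (f s)) + Re (f s)))
     _ _ p0' (derM (dercst 2 t) (derD dm f1)).
  have pn0 : Num.sqrt (2 * (Num.sqrt (Re (f t) * Re (f t) + Im (f t) * Im (f
    t)) + Re (f t))) != 0.
    by rewrite lt0r_neq0// sqrtr_gt0.
  have dV := @derV _ (fun s => Num.sqrt (2 * (Num.sqrt (Re (f s) * Re (f s) +
    Im (f s) * Im (f s)) + Re (f s))))
     _ _ pn0 dp.
  have d1 := derM dp (dercst 2^-1 t).
  have d2 := derM f2 dV.
  have mk a b : is_derive t 1 (fun s => Re (csqrt (f s))) a ->
      is_derive t 1 (fun s => Im (csqrt (f s))) b ->
      exists l, cder (fun s => csqrt (f s)) t l by exists (a +i* b).
  exact: mk d1 d2.
apply: (cder_eq hl).
have sn0 : csqrt (f t) != 0 by rewrite csqrt_eq0.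
have -> : k = l * csqrt (f t) + csqrt (f t) * l; last by field.
apply: (cder_unique fk).
apply: cder_near_eq (cderM hl hl).
by near=> s; rewrite -expr2 csqrtK//; near: s.
Unshelve. all: by end_near. Qed.

End square_root.

(** * The integrands of a characteristic exponent *)

Section levy_integrand.
Variable R : realType.
Local Notation Re := complex.Re.
Local Notation Im := complex.Im.

Lemma normr_sin_le (u : R) : `|sin u| <= `|u|.
Proof.
wlog u0 : u / 0 <= u => [h|].
  have [/h//|/ltW u0] := leP 0 u.
  by rewrite -normrN -sinN -[leRHS]normrN h// oppr_ge0.
have dsin x : x \in `]0, u[%R -> is_derive x 1 (@sin R) (cos x).
  by move=> _; exact: is_derive_sin.
have [c _] := MVT_segment u0 dsin (continuous_subspaceT (@continuous_sin R)).
rewrite sin0 !subr0 => ->.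
by rewrite normrM ler_piMl// cos_max.
Qed.

Lemma normr_cosB1_le (u : R) : `|cos u - 1| <= `|u|.
Proof.
wlog u0 : u / 0 <= u => [h|].
  have [/h//|/ltW u0] := leP 0 u.
  by rewrite -cosN -[leRHS]normrN h// oppr_ge0.
have dcos x : x \in `]0, u[%R -> is_derive x 1 (@cos R) (- sin x).
  by move=> _; exact: is_derive_cos.
have [c _] := MVT_segment u0 dcos (continuous_subspaceT (@continuous_cos R)).
rewrite cos0 !subr0 => ->.
by rewrite normrM ler_piMl// normrN sin_max.
Qed.

Lemma expRN_le1 (v : R) : 0 <= v -> expR (- v) <= 1.
Proof. by move=> v0; rewrite -[leRHS]expR0 ler_expR oppr_le0. Qed.

(** Real and imaginary parts of exp(i x z) - 1 and of x exp(i x z): the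
integrands of a characteristic exponent and of its derivative. *)
Definition levyR (z : R[i]) (x : R) := expR (- (x * Im z)) * cos (x * Re z) - 1.
Definition levyI (z : R[i]) (x : R) := expR (- (x * Im z)) * sin (x * Re z).
Definition dlevyC (z : R[i]) (x : R) := x * (expR (- (x * Im z)) * cos (x * Re z)).
Definition dlevyS (z : R[i]) (x : R) := x * (expR (- (x * Im z)) * sin (x * Re z)).

Lemma levyE (z : R[i]) (x : R) :
  cexp ('i%C * x%:C * z) - 1 = levyR z x +i* levyI z x.
Proof.
have eR : Re ('i%C * x%:C * z) = - (x * Im z) by rewrite !(ReM, ImM)/=; ring.
have eI : Im ('i%C * x%:C * z) = x * Re z by rewrite !(ReM, ImM)/=; ring.
by apply: complexP; rewrite ?(ReD, ImD, ReN, ImN)/= eR eI// subr0.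
Qed.

Lemma levyR_le (z : R[i]) x : 0 <= Im z -> 0 < x ->
  `|levyR z x| <= (2 + `|Re z| + `|Im z|) * Num.min 1 x.
Proof.
move=> z0 x0; have xz : 0 <= x * Im z by rewrite mulr_ge0// ltW.
have e1 := expRN_le1 xz; have e0 := expR_ge0 (- (x * Im z)).
have [x1|/ltW x1] := leP 1 x.
  rewrite mulr1 (le_trans (ler_normB _ _))//.
  rewrite normr1 normrM (ger0_norm e0).
  have h : expR (- (x * Im z)) * `|cos (x * Re z)| <= 1.
    by rewrite mulr_ile1// cos_max.
  have := normr_ge0 (Re z); have := normr_ge0 (Im z); lra.
have -> : levyR z x = expR (- (x * Im z)) * (cos (x * Re z) - 1)
   + (expR (- (x * Im z)) - 1) by rewrite /levyR; ring.
rewrite (le_trans (ler_normD _ _))//.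
have h1 : `|expR (- (x * Im z)) * (cos (x * Re z) - 1)| <= x * `|Re z|.
  rewrite normrM (ger0_norm e0) (le_trans (ler_piMl _ e1))//.
  by rewrite (le_trans (normr_cosB1_le _))// normrM (gtr0_norm x0).
have h2 : `|expR (- (x * Im z)) - 1| <= x * `|Im z|.
  rewrite ler0_norm ?subr_le0// (ger0_norm z0).
  by have := expR_ge1Dx (- (x * Im z)); lra.
have := lerD h1 h2; move=> /le_trans; apply.
rewrite -mulrDr mulrC ler_wpM2r ?(ltW x0)//; lra.
Qed.

Lemma levyI_le (z : R[i]) x : 0 <= Im z -> 0 < x ->
  `|levyI z x| <= (2 + `|Re z| + `|Im z|) * Num.min 1 x.
Proof.
move=> z0 x0; have xz : 0 <= x * Im z by rewrite mulr_ge0// ltW.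
have e1 := expRN_le1 xz; have e0 := expR_ge0 (- (x * Im z)).
have a0 := normr_ge0 (Re z); have b0 := normr_ge0 (Im z).
rewrite normrM (ger0_norm e0); have [x1|/ltW x1] := leP 1 x.
  have h : expR (- (x * Im z)) * `|sin (x * Re z)| <= 1.
    by rewrite mulr_ile1// sin_max.
  by rewrite mulr1; lra.
rewrite (le_trans (ler_piMl _ e1))// (le_trans (normr_sin_le _))//.
rewrite normrM (gtr0_norm x0) mulrC ler_wpM2r ?(ltW x0)//; lra.
Qed.

(** In the open upper half-plane the exponential decay turns the factor x, not
integrable at infinity, into something comparable with min(1, x). *)
Lemma mulr_expRN_le (eta b x : R) : 0 < eta -> eta <= b -> 0 < x ->
  x * expR (- (x * b)) <= (1 + eta^-1) * Num.min 1 x.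
Proof.
move=> eta0 etab x0;
  have xb : 0 <= x * b by rewrite mulr_ge0 ?(ltW x0)// (le_trans _ etab)// ltW.
have ei : 0 <= eta^-1 by rewrite invr_ge0 ltW.
have [x1|/ltW x1] := leP 1 x; last first.
  rewrite (le_trans (ler_piMr _ (expRN_le1 xb))) ?(ltW x0)//.
  by rewrite ler_peMl ?(ltW x0)// lerDl.
rewrite mulr1 expRN ler_pdivrMr ?expR_gt0//.
have h : 1 + x * eta <= expR (x * b).
  by rewrite (le_trans (expR_ge1Dx _))// ler_expR ler_wpM2l// ltW.
have h1 : x = eta^-1 * (x * eta) by field; rewrite lt0r_neq0.
have h2 : eta^-1 * (x * eta) <= eta^-1 * expR (x * b) by rewrite ler_wpM2l//; lra.
have := expR_ge0 (x * b); lra.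
Qed.

Lemma dlevyC_le eta (z : R[i]) x : 0 < eta -> eta <= Im z -> 0 < x ->
  `|dlevyC z x| <= (1 + eta^-1) * Num.min 1 x.
Proof.
move=> eta0 etaz x0; apply: le_trans (mulr_expRN_le eta0 etaz x0).
rewrite /dlevyC !normrM (gtr0_norm x0) ler_wpM2l ?(ltW x0)//.
by rewrite (ger0_norm (expR_ge0 _)) ler_piMr ?expR_ge0// cos_max.
Qed.

Lemma dlevyS_le eta (z : R[i]) x : 0 < eta -> eta <= Im z -> 0 < x ->
  `|dlevyS z x| <= (1 + eta^-1) * Num.min 1 x.
Proof.
move=> eta0 etaz x0; apply: le_trans (mulr_expRN_le eta0 etaz x0).
rewrite /dlevyS !normrM (gtr0_norm x0) ler_wpM2l ?(ltW x0)//.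
by rewrite (ger0_norm (expR_ge0 _)) ler_piMr ?expR_ge0// sin_max.
Qed.

Lemma der_measurable (f : R -> R) (D : set R) :
  (forall x : R, exists a : R, is_derive x 1 f a) -> measurable_fun D f.
Proof.
move=> fd; apply: measurable_funTS; apply: continuous_measurable_fun => x.
by have [a /der_cvg] := fd x.
Qed.

Let dexpx (b x : R) := derexp (derN (derM (derid x) (dercst b x))).
Let dcosx (b x : R) := dercos (derM (derid x) (dercst b x)).
Let dsinx (b x : R) := dersin (derM (derid x) (dercst b x)).

Lemma measurable_levyR z D : measurable_fun D (levyR z).
Proof.
by apply: der_measurable => x; eexists;
  exact: (derD (derM (dexpx _ x) (dcosx _ x)) (dercst _ x)).
Qed.

Lemma measurable_levyI z D : measurable_fun D (levyI z).
Proof.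
by apply: der_measurable => x; eexists; exact: (derM (dexpx _ x) (dsinx _ x)).
Qed.

Lemma measurable_dlevyC z D : measurable_fun D (dlevyC z).
Proof.
by apply: der_measurable => x; eexists;
  exact: (derM (derid x) (derM (dexpx _ x) (dcosx _ x))).
Qed.

Lemma measurable_dlevyS z D : measurable_fun D (dlevyS z).
Proof.
by apply: der_measurable => x; eexists;
  exact: (derM (derid x) (derM (dexpx _ x) (dsinx _ x))).
Qed.

Lemma cder_levyR (g : R -> R[i]) v (t x : R) : cder g t v ->
  is_derive t 1 (fun s => levyR (g s) x)
    (- (Im v * dlevyC (g t) x + Re v * dlevyS (g t) x)).
Proof.
move=> [g1 g2].
have h := derD (derM (derexp (derN (derM (dercst x t) g2)))
  (dercos (derM (dercst x t) g1))) (dercst (-1) t).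
by apply: (is_derive_eq h); rewrite /dlevyC /dlevyS; ring.
Qed.

Lemma cder_levyI (g : R -> R[i]) v (t x : R) : cder g t v ->
  is_derive t 1 (fun s => levyI (g s) x)
    (Re v * dlevyC (g t) x - Im v * dlevyS (g t) x).
Proof.
move=> [g1 g2].
have h := derM (derexp (derN (derM (dercst x t) g2)))
  (dersin (derM (dercst x t) g1)).
by apply: (is_derive_eq h); rewrite /dlevyC /dlevyS; ring.
Qed.

Lemma cvg_expcos T (F : set_system T) {FF : Filter F} (g : T -> R[i]) z x :
  ccvg F g z -> expR (- (x * Im (g t))) * cos (x * Re (g t)) @[t --> F]
    --> expR (- (x * Im z)) * cos (x * Re z).
Proof.
move=> [g1 g2]; apply: cvgM; (apply: continuous_cvg;
  first by [exact: continuous_expR|exact: continuous_cos]).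
- by apply: cvgN; exact: cvgMr.
- exact: cvgMr.
Qed.

Lemma cvg_expsin T (F : set_system T) {FF : Filter F} (g : T -> R[i]) z x :
  ccvg F g z -> expR (- (x * Im (g t))) * sin (x * Re (g t)) @[t --> F]
    --> expR (- (x * Im z)) * sin (x * Re z).
Proof.
move=> [g1 g2]; apply: cvgM; (apply: continuous_cvg;
  first by [exact: continuous_expR|exact: continuous_sin]).
- by apply: cvgN; exact: cvgMr.
- exact: cvgMr.
Qed.

End levy_integrand.

(** * Integrals depending on a parameter; subordinator exponents *)

Section integral_tools.
Context {R : realType} {d : measure_display} {Y : measurableType d}.
Variables (mu : {measure set Y -> \bar R}) (D : set Y) (mD : measurable D).

Lemma dominated_integrable_EFin (f g : Y -> R) : measurable_fun D f ->
  mu.-integrable D (EFin \o g) -> (forall x, D x -> `|f x| <= g x) ->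
  mu.-integrable D (EFin \o f).
Proof.
move=> mf ig fg; apply: (le_integrable mD _ _ ig); first exact/measurable_EFinP.
by move=> x Dx; rewrite /= lee_fin (le_trans (fg _ Dx))// ler_norm.
Qed.

Lemma is_derive_Rintegral (f df : R -> Y -> R) (G : Y -> R) (a b t : R) :
  a < t < b ->
  (forall s, a < s < b -> mu.-integrable D (EFin \o f s)) ->
  (forall s y, a < s < b -> D y -> is_derive s 1 (f ^~ y) (df s y)) ->
  mu.-integrable D (EFin \o G) ->
  (forall s y, a < s < b -> D y -> `|df s y| <= G y) ->
  is_derive t 1 (fun s => \int[mu]_(y in D) f s y) (\int[mu]_(y in D) df t y).
Proof.
move=> atb intf der intG Gub.
pose I : set R := `]a, b[%classic.
have II s : I s -> a < s < b by rewrite /I/= in_itv.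
have It : I t by rewrite /I/= in_itv.
have int' s : I s -> mu.-integrable D (EFin \o f s) by move=> /II; exact: intf.
have der' s y : I s -> D y -> derivable (f ^~ y) s 1.
  by move=> /II hs Dy; have [] := der s y hs Dy.
have par s y : I s -> D y -> partial1of2 f s y = df s y.
  by move=> /II hs Dy; rewrite partial1of2E; have [] := der s y hs Dy.
pose G' y := `|G y|.
have G'0 y : 0 <= G' y by exact: normr_ge0.
have intG' : mu.-integrable D (EFin \o G') by exact: (integrable_abse intG).
have G'ub s y : I s -> D y -> `|partial1of2 f s y| <= G' y.
  move=> Is Dy; rewrite par// (le_trans (Gub _ _ (II _ Is) Dy))//; exact: ler_norm.
apply: DeriveDef;
  first exact: (derivable_under_integral mD It int' der' G'0 intG' G'ub).
rewrite -derive1E (differentiation_under_integral mD It int' der' G'0 intG' G'ub).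
by apply: eq_Rintegral => y /set_mem Dy; rewrite par.
Qed.

Lemma cvg_Rintegral (f_ : nat -> Y -> R) (f G : Y -> R) :
  (forall n, measurable_fun D (f_ n)) -> measurable_fun D f ->
  {ae mu, forall x, D x -> f_ n x @[n --> \oo] --> f x} ->
  mu.-integrable D (EFin \o G) ->
  (forall n x, D x -> `|f_ n x| <= G x) ->
  \int[mu]_(x in D) f_ n x @[n --> \oo] --> \int[mu]_(x in D) f x.
Proof.
move=> mf_ mf cf iG fG.
have mf_' n : measurable_fun D (EFin \o f_ n) by exact/measurable_EFinP.
have mf' : measurable_fun D (EFin \o f) by exact/measurable_EFinP.
have cf' : {ae mu, forall x, D x -> (f_ n x)%:E @[n --> \oo] --> (f x)%:E}.
  by apply: filterS cf => x h Dx; apply: cvg_EFin; [exact: nearW|exact: h].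
have bd : {ae mu, forall x n, D x -> (`|(f_ n x)%:E| <= (G x)%:E)%E}.
  by apply: aeW => x n Dx; rewrite lee_fin; exact: fG.
have [if_ _ cint] := @dominated_convergence _ _ _ mu _ mD (fun n => EFin \o f_ n)
  (EFin \o f) (EFin \o G) mf_' mf' cf' iG bd.
apply: fine_cvg; move: cint; rewrite fineK//.
exact: integrable_fin_num.
Qed.

End integral_tools.

Section curves.
Variable R : realType.
Local Notation Re := complex.Re.
Local Notation Im := complex.Im.
Local Notation normc := ComplexField.Normc.normc.

(** Velocity bounded and image bounded away from the real line: the conditions
under which one may differentiate under the integral sign of an exponent along
the curve. *)
Definition good_curve (g v : R -> R[i]) (a b : R) :=
  (forall t, a < t < b -> cder g t (v t)) /\
  exists2 eta : R, 0 < eta & exists M : R, forall t, a < t < b ->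
    [/\ eta <= Im (g t), `|Re (v t)| <= M & `|Im (v t)| <= M].

(** Holomorphy on the open upper half-plane in the form in which it is used,
as a complex chain rule along real curves with a continuous derivative. *)
Record holomorphic (f df : R[i] -> R[i]) : Prop := Holomorphic {
  holo_chain : forall g v a b t, good_curve g v a b -> a < t < b ->
    cder (f \o g) t (df (g t) * v t) ;
  holo_cont : forall g v a b t, good_curve g v a b -> a < t < b ->
    ccvg (nbhs t) (df \o g) (df (g t)) }.

End curves.

Section halfplane_exponent.
Variables (R : realType) (q delta : R) (mu : {measure set R -> \bar R}).
Hypotheses (q0 : 0 <= q) (delta0 : 0 <= delta).
Local Notation Re := complex.Re.
Local Notation Im := complex.Im.
Local Notation normc := ComplexField.Normc.normc.
Local Notation D := (`]0%R, +oo[%classic : set R).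
Hypothesis mu_fin : (\int[mu]_(x in D) (Num.min 1 x)%:E < +oo)%E.

Let m1 (x : R) : R := Num.min 1 x.

Let mD : measurable D. Proof. exact: measurable_itv. Qed.
Let DP x : D x -> 0 < x. Proof. by rewrite /= in_itv/= andbT. Qed.

Let intm C : mu.-integrable D (EFin \o (fun x => C * m1 x)).
Proof.
suff : mu.-integrable D (EFin \o m1).
  by move=> /(integrableZl mD C); apply: eq_integrable => // x _.
apply/integrableP; split.
  by apply/measurable_EFinP/measurable_funTS/measurable_minr.
rewrite (eq_integral (fun x => (m1 x)%:E))// => x /set_mem /DP x0 /=.
by rewrite ger0_norm// /m1 le_min ler01 ltW.
Qed.

(** The exponent q - i delta z - int (exp(i x z) - 1) mu(dx) and its derivative
- i delta - int i x exp(i x z) mu(dx), by real and imaginary parts. *)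
Definition levy_exp (z : R[i]) : R[i] :=
  (q + delta * Im z - \int[mu]_(x in D) levyR z x)
   +i* (- (delta * Re z) - \int[mu]_(x in D) levyI z x).

Definition dlevy_exp (z : R[i]) : R[i] :=
  (\int[mu]_(x in D) dlevyS z x) +i* (- (delta + \int[mu]_(x in D) dlevyC z x)).

Let intR z : 0 <= Im z -> mu.-integrable D (EFin \o levyR z).
Proof.
move=> z0; apply: (dominated_integrable_EFin mD (@measurable_levyR _ z D) (intm _)).
by move=> x /DP; exact: levyR_le.
Qed.

Let intI z : 0 <= Im z -> mu.-integrable D (EFin \o levyI z).
Proof.
move=> z0; apply: (dominated_integrable_EFin mD (@measurable_levyI _ z D) (intm _)).
by move=> x /DP; exact: levyI_le.
Qed.

Let intC z : 0 < Im z -> mu.-integrable D (EFin \o dlevyC z).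
Proof.
move=> z0; apply: (dominated_integrable_EFin mD (@measurable_dlevyC _ z D)
  (intm _)).
by move=> x /DP; exact: dlevyC_le z0 (lexx _).
Qed.

Let intS z : 0 < Im z -> mu.-integrable D (EFin \o dlevyS z).
Proof.
move=> z0; apply: (dominated_integrable_EFin mD (@measurable_dlevyS _ z D)
  (intm _)).
by move=> x /DP; exact: dlevyS_le z0 (lexx _).
Qed.

Lemma levy_exp_cvg (u : nat -> R[i]) (z : R[i]) : (forall n, 0 <= Im (u n)) ->
  ccvg \oo u z -> ccvg \oo (levy_exp \o u) (levy_exp z).
Proof.
move=> u0 uz; have [u1 u2] := uz.
have [M HM] : exists M, forall n, 2 + `|Re (u n)| + `|Im (u n)| <= M.
  have [M1 [_ h1]] := cvg_seq_bounded (cvgP _ u1).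
  have [M2 [_ h2]] := cvg_seq_bounded (cvgP _ u2).
  exists (2 + (M1 + 1) + (M2 + 1)) => n.
  have a1 : `|Re (u n)| <= M1 + 1 by apply: h1 => //; rewrite ltrDl.
  have a2 : `|Im (u n)| <= M2 + 1 by apply: h2 => //; rewrite ltrDl.
  by rewrite !lerD.
have mM x : 0 < x -> 0 <= m1 x by move=> x0; rewrite /m1 le_min ler01 ltW.
have bR n x : D x -> `|levyR (u n) x| <= M * m1 x.
  move=> /DP x0; rewrite (le_trans (levyR_le (u0 n) x0))//.
  by rewrite ler_wpM2r//; exact: mM.
have bI n x : D x -> `|levyI (u n) x| <= M * m1 x.
  move=> /DP x0; rewrite (le_trans (levyI_le (u0 n) x0))//.
  by rewrite ler_wpM2r//; exact: mM.
split => /=.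
- apply: cvgB; first by apply: cvgD; [exact: cvg_cst|exact: cvgMr].
  apply: (cvg_Rintegral mD _ _ _ (intm M) bR) => //.
  + by move=> n; exact: measurable_levyR.
  + exact: measurable_levyR.
  + apply: aeW => x _; apply: cvgB; last exact: cvg_cst.
    exact: cvg_expcos.
- apply: cvgB; first by apply: cvgN; exact: cvgMr.
  apply: (cvg_Rintegral mD _ _ _ (intm M) bI) => //.
  + by move=> n; exact: measurable_levyI.
  + exact: measurable_levyI.
  + by apply: aeW => x _; exact: cvg_expsin.
Qed.

(** Differentiation under the integral sign; the domination is uniform along a
good curve, which also gives the continuity of the derivative. *)
Lemma holomorphic_levy_exp : holomorphic levy_exp dlevy_exp.
Proof.
split => g v a b t [dg [eta eta0 [M HM]]] atb.
  have g0 s : a < s < b -> 0 < Im (g s).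
    by move=> /HM[h _ _]; exact: lt_le_trans h.
  have mM x : 0 < x -> 0 <= m1 x by move=> x0; rewrite /m1 le_min ler01 ltW.
  have bd s x : a < s < b -> D x ->
     `|Im (v s) * dlevyC (g s) x| <= M * (1 + eta^-1) * m1 x /\
     `|Re (v s) * dlevyC (g s) x| <= M * (1 + eta^-1) * m1 x /\
     `|Im (v s) * dlevyS (g s) x| <= M * (1 + eta^-1) * m1 x /\
     `|Re (v s) * dlevyS (g s) x| <= M * (1 + eta^-1) * m1 x.
    move=> /HM[h1 h2 h3] /DP x0.
    have hC := dlevyC_le eta0 h1 x0.
    have hS := dlevyS_le eta0 h1 x0.
    have P k c e f : `|k| <= M -> `|c| <= f -> e = M * f -> `|k * c| <= e :> R.
      by move=> ha hc ->; rewrite normrM ler_pM.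
    by split; [|split; [|split]]; (apply: P;
      [eassumption|eassumption|rewrite mulrA]).
  have bR s x : a < s < b -> D x ->
      `|- (Im (v s) * dlevyC (g s) x + Re (v s) * dlevyS (g s) x)| <=
      2 * (M * (1 + eta^-1)) * m1 x.
    move=> hs Dx; have [h1 [_ [_ h4]]] := bd s x hs Dx.
    rewrite normrN (le_trans (ler_normD _ _))//.
    by have := lerD h1 h4; lra.
  have bI s x : a < s < b -> D x ->
      `|Re (v s) * dlevyC (g s) x - Im (v s) * dlevyS (g s) x| <=
      2 * (M * (1 + eta^-1)) * m1 x.
    move=> hs Dx; have [_ [h1 [h4 _]]] := bd s x hs Dx.
    rewrite (le_trans (ler_normB _ _))//.
    by have := lerD h1 h4; lra.
  have dR := is_derive_Rintegral mD atb
    (fun s hs => intR (ltW (g0 s hs)))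
    (fun s x hs _ => cder_levyR x (dg s hs))
    (intm (2 * (M * (1 + eta^-1)))) bR.
  have dI := is_derive_Rintegral mD atb
    (fun s hs => intI (ltW (g0 s hs)))
    (fun s x hs _ => cder_levyI x (dg s hs))
    (intm (2 * (M * (1 + eta^-1)))) bI.
  have [dg1 dg2] := dg t atb.
  have iC := intC (g0 t atb); have iS := intS (g0 t atb).
  have iZ c f : mu.-integrable D (EFin \o f) ->
      mu.-integrable D (EFin \o (fun x => c * f x)).
    by move=> /(integrableZl mD c); apply: eq_integrable => // x _.
  have iD f h : mu.-integrable D (EFin \o f) -> mu.-integrable D (EFin \o h) ->
      mu.-integrable D (EFin \o (fun x => f x + h x)).
    by move=> hf hh; apply: eq_integrable (integrableD mD hf hh).
  split => /=.
  - apply: (is_derive_eq (derD (derD (dercst q t) (derM (dercst delta t) dg2))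
      (derN dR))).
    rewrite ReM /dlevy_exp/=.
    under eq_Rintegral do rewrite -mulN1r.
    rewrite RintegralZl//; last by apply: iD; exact: iZ.
    rewrite RintegralD//; [|exact: iZ|exact: iZ].
    by rewrite !RintegralZl//; ring.
  - apply: (is_derive_eq (derD (derN (derM (dercst delta t) dg1)) (derN dI))).
    rewrite ImM /dlevy_exp/=.
    rewrite RintegralB//; [|exact: iZ|exact: iZ].
    by rewrite !RintegralZl//; ring.
have g0 s : a < s < b -> 0 < Im (g s).
  by move=> /HM[h _ _]; exact: lt_le_trans h.
have tI : t \in (`]a, b[%classic : set R) by rewrite inE/= in_itv.
have II s : (`]a, b[%classic : set R) s -> a < s < b by rewrite /= in_itv.
split => /=.
- apply: (continuity_under_integral mD (u := a) (v := b) _ _ (intm (1 +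
  eta^-1))) => //.
  + by move=> s /II hs; exact: intS (g0 s hs).
  + apply: aeW => x _ s /set_mem/II hs; apply: cvgMr.
    by apply: cvg_expsin; exact: (cder_cvg (dg s hs)).
  + move=> s /II hs; apply: aeW => x /DP x0; have [h _ _] := HM s hs.
    exact: dlevyS_le.
- apply: cvgN; apply: cvgD; first exact: cvg_cst.
  apply: (continuity_under_integral mD (u := a) (v := b) _ _ (intm (1 +
    eta^-1))) => //.
  + by move=> s /II hs; exact: intC (g0 s hs).
  + apply: aeW => x _ s /set_mem/II hs; apply: cvgMr.
    by apply: cvg_expcos; exact: (cder_cvg (dg s hs)).
  + move=> s /II hs; apply: aeW => x /DP x0; have [h _ _] := HM s hs.
    exact: dlevyC_le.
Qed.

Lemma dlevy_exp_bound eta : 0 < eta -> exists K : R, forall z, eta <= Im z ->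
  normc (dlevy_exp z) <= K.
Proof.
move=> eta0.
pose I1 := \int[mu]_(x in D) ((1 + eta^-1) * m1 x).
exists (I1 + (delta + I1)) => z hz.
have z0 := lt_le_trans eta0 hz.
have bnd f : mu.-integrable D (EFin \o f) ->
    (forall x, 0 < x -> `|f x| <= (1 + eta^-1) * m1 x) ->
    `|\int[mu]_(x in D) f x| <= I1.
  move=> intf hf; rewrite (le_trans (le_normr_Rintegral mD intf))//.
  apply: le_Rintegral => //; first exact: (integrable_abse intf).
  by move=> x /DP; exact: hf.
rewrite (le_trans (normc_leD _))//= lerD ?bnd//.
- exact: intS.
- by move=> x x0; exact: dlevyS_le.
rewrite normrN (le_trans (ler_normD _ _))// ger0_norm// lerD2l bnd//.
- exact: intC.
- by move=> x x0; exact: dlevyC_le.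
Qed.

(** Since the cosine is at most 1, the real part of an exponent at a + i b is
at least its value at i y for every y below b. *)
Lemma Re_levy_exp_mono z y : 0 <= y <= Im z ->
  Re (levy_exp (0 +i* y)) <= Re (levy_exp z).
Proof.
move=> /andP[y0 yz]; have z0 := le_trans y0 yz.
rewrite /levy_exp /= lerB//; first by rewrite lerD2l ler_wpM2l.
apply: le_Rintegral => //; [exact: intR|exact: intR|].
move=> x /DP x0; rewrite /levyR /= mulr0 cos0 mulr1 lerB//.
rewrite (le_trans (ler_piMr (expR_ge0 _) (cos_le1 _)))// ler_expR lerN2.
by rewrite ler_wpM2l// ltW.
Qed.

Let levyR_le0 (z : R[i]) (x : R) : 0 <= Im z -> 0 < x -> levyR z x <= 0.
Proof.
move=> z0 x0; rewrite subr_le0 (le_trans (ler_piMr (expR_ge0 _) (cos_le1 _)))//.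
by rewrite expRN_le1// mulr_ge0// ltW.
Qed.

Let intR_le0 z : 0 <= Im z -> \int[mu]_(x in D) levyR z x <= 0.
Proof.
move=> z0; rewrite -oppr_ge0 -mulN1r -RintegralZl//; last exact: intR.
by apply: Rintegral_ge0 => x /DP x0; rewrite mulN1r oppr_ge0; exact: levyR_le0.
Qed.

Lemma Re_levy_exp_ge0 z : 0 <= Im z -> 0 <= Re (levy_exp z).
Proof.
move=> z0; rewrite /levy_exp/= subr_ge0 (le_trans (intR_le0 z0))//.
by rewrite addr_ge0// mulr_ge0.
Qed.

(** The real part of an exponent is a sum of three nonnegative terms. *)
Lemma Re_levy_exp_eq0 z : 0 <= Im z -> Re (levy_exp z) = 0 ->
  [/\ q = 0, delta * Im z = 0 & {ae mu, forall x, D x -> levyR z x = 0}].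
Proof.
move=> z0; rewrite /levy_exp/= => h.
have h1 := intR_le0 z0; have h2 : 0 <= delta * Im z by rewrite mulr_ge0.
have [q00 d0 I0] : [/\ q = 0, delta * Im z = 0 & \int[mu]_(x in D) levyR z x = 0].
  by move: h h1 h2 q0; move: (delta * Im z) (Rintegral _ _ _) => a b *; split; lra.
split=> //.
have mR : measurable_fun D (EFin \o levyR z).
  by apply/measurable_EFinP; exact: measurable_levyR.
suff : ae_eq mu D (EFin \o levyR z) (cst 0%E).
  by apply: filterS => x hx Dx; have := hx Dx; case.
apply/(ae_eq_integral_abs mu mD mR).
rewrite (eq_integral (fun x => (- levyR z x)%:E)); last first.
  by move=> x /set_mem/DP x0 /=; rewrite ler0_norm// levyR_le0.
have iN : mu.-integrable D (EFin \o (fun x => - levyR z x)).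
  by move: (integrableN (intR z0)); apply: eq_integrable.
rewrite -[LHS]fineK; last exact: integrable_fin_num iN.
have -> : fine (\int[mu]_(x in D) (- levyR z x)%:E)%E = - \int[mu]_(x in D)
  levyR z x.
  rewrite -mulN1r -RintegralZl//; last exact: intR.
  by congr fine; apply: eq_integral => x _; rewrite mulN1r.
by rewrite I0 oppr0.
Qed.

Let Rintegral_null f : {ae mu, forall x, ~ D x} -> measurable_fun D f ->
  \int[mu]_(x in D) f x = 0.
Proof.
move=> n mf; rewrite /Rintegral (ae_eq_integral (cst 0%E))//.
- by rewrite integral0.
- exact/measurable_EFinP.
- by apply: filterS n => x nD Dx.
Qed.

Let levy_exp_null z : {ae mu, forall x, ~ D x} ->
  levy_exp z = (q + delta * Im z) +i* (- (delta * Re z)).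
Proof.
move=> n; rewrite /levy_exp !Rintegral_null ?subr0//;
  [exact: measurable_levyI|exact: measurable_levyR].
Qed.

Section nondegenerate.
Variable x0 : R.
Hypothesis levy_exp_neq0 : levy_exp x0%:C != 0.

Lemma Re_levy_exp_gt0 (y : R) : 0 < y -> 0 < Re (levy_exp (0 +i* y)).
Proof.
move=> y0; rewrite lt_neqAle Re_levy_exp_ge0 ?(ltW y0)// andbT; apply/eqP => /esym.
move=> /(@Re_levy_exp_eq0 (0 +i* y) (ltW y0))[q00 /eqP];
  rewrite mulf_eq0 (gt_eqF y0) orbF => /eqP d0 n.
have null : {ae mu, forall x, ~ D x}.
  apply: filterS n => x h Dx; have := h Dx; have x00 := DP Dx.
  rewrite /levyR/= mulr0 cos0 mulr1 => /eqP; rewrite subr_eq0 => /eqP e1.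
  have : expR (- (x * y)) < 1 by rewrite expR_lt1 oppr_lt0 mulr_gt0.
  by rewrite e1 ltxx.
by move: levy_exp_neq0;
  rewrite (levy_exp_null _ null) q00 d0 !mul0r oppr0 addr0 eqxx.
Qed.

(* The frequencies at which mu is carried by a lattice; it contains the real
   zeros of the exponent and, unlike them, is visibly a group. *)
Let Z' : set R := [set x | {ae mu, forall u, D u -> cos (u * x) = 1}].

Let Z'B x y : Z' x -> Z' y -> Z' (x - y).
Proof.
rewrite /Z' /= => hx hy; near=> u => Du.
have cx : cos (u * x) = 1 by move: Du; near: u.
have cy : cos (u * y) = 1 by move: Du; near: u.
have s0 t : cos t = 1 -> sin t = 0 :> R.
  move=> ct; have := cos2Dsin2 t; rewrite ct expr1n => /eqP.
  by rewrite addrC -subr_eq0 addrK sqrf_eq0 => /eqP.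
by rewrite mulrBr cosB cx cy (s0 _ cx) mul0r mulr1 addr0.
Unshelve. all: end_near. Qed.

(** Frequencies x_n tending to 0 would give u * x_n in (2 pi Z) for almost
every u and all n, which is impossible for u > 0 once |u * x_n| < 1. *)
Let Z'_separated : ~ {ae mu, forall x, ~ D x} ->
  exists2 e : R, 0 < e & forall x, Z' x -> x != 0 -> e <= `|x|.
Proof.
move=> nn; apply: contrapT => h; apply: nn.
have /choice[x Hx] : forall n : nat, exists x, [/\ Z' x, x != 0 & `|x| <
  n.+1%:R^-1].
  move=> n; apply: contrapT => hn; apply: h; exists n.+1%:R^-1 => // x Zx xn0.
  by rewrite leNgt; apply/negP => hx; apply: hn; exists x.
have : {ae mu, forall u, forall n, D u -> cos (u * x n) = 1}.
  by apply/ae_foralln => n; have [] := Hx n.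
apply: filterS => u hu Du; have u0 := DP Du.
have [n un] : exists n : nat, u < n.+1%:R.
  exists (Num.trunc u); exact: truncnS_gt.
have [_ xn0 xn] := Hx n.
have := hu n Du; set t := u * x n => ct.
have t1 : `|t| < 1.
  rewrite normrM (gtr0_norm u0).
  have : u * `|x n| < n.+1%:R * n.+1%:R^-1.
    by rewrite ltr_pM// ltW.
  by rewrite divff.
have : `|t| = 0.
  have := @pi_ge2 R => pi2.
  apply: (@cos_inj R); rewrite ?in_itv/= ?lexx ?normr_ge0 ?pi_ge0//=; first lra.
  rewrite cos0; have [tt|tt] := leP 0 t; first by rewrite ger0_norm.
  by rewrite ltr0_norm// cosN.
by move/eqP; rewrite normr_eq0 mulf_eq0 (gt_eqF u0) (negbTE xn0).
Qed.

(** Either mu vanishes and the exponent is affine, or the zeros lie in a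
subgroup of R without small nonzero elements, on which floor (x / e) is
injective. *)
Lemma countable_levy_exp_zeros : countable [set x : R | levy_exp x%:C = 0].
Proof.
have Z0 x : levy_exp x%:C = 0 -> q = 0 /\ Z' x.
  move=> l0; have [] := @Re_levy_exp_eq0 x%:C (lexx _); first by rewrite l0.
  move=> -> _ n; split=> //; apply: filterS n => u hu Du; move: (hu Du).
  by rewrite /levyR/= mulr0 oppr0 expR0 mul1r => /eqP; rewrite subr_eq0 => /eqP.
have [null|nn] := pselect {ae mu, forall x, ~ D x}.
  apply: (@sub_countable _ _ _ [set (0:R)]); last exact: countable1.
  apply: subset_card_le => x /= l0; have [q00 _] := Z0 _ l0.
  move: l0 levy_exp_neq0; rewrite !levy_exp_null// q00/= mulr0 addr0 => -[/eqP].
  rewrite oppr_eq0 mulf_eq0 => /orP[/eqP->|/eqP//].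
  by rewrite mul0r oppr0 eqxx.
have [e e0 he] := Z'_separated nn.
have i0 : 0 <= e^-1 by rewrite invr_ge0 ltW.
apply: (@sub_countable _ _ _ Z'); first by apply: subset_card_le => x /Z0[].
apply/countable_injP; exists (fun x : R => pickle (Num.floor (x / e))).
move=> x y /set_mem Zx /set_mem Zy /(pcan_inj pickleK) fxy.
apply/eqP; rewrite -subr_eq0; apply/negPn/negP => xy0.
have := he _ (Z'B Zx Zy) xy0.
have /andP[x1 x2] := floor_itv (x / e); have /andP[y1 y2] := floor_itv (y / e).
rewrite leNgt => /negP; apply.
rewrite fxy in x1 x2; rewrite intrD in x2 y2.
have : `|(x - y) / e| < 1.
  by rewrite ltr_norml mulrBl; apply/andP; split; lra.
by rewrite normrM normfV (gtr0_norm e0) ltr_pdivrMr// mul1r.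
Qed.

End nondegenerate.

Lemma levy_expJ (x : R) : levy_exp (- x%:C) = (levy_exp x%:C)^*.
Proof.
have hI : \int[mu]_(u in D) levyI (- x%:C) u = - \int[mu]_(u in D) levyI x%:C u.
  rewrite -[RHS]mulN1r -RintegralZl//; last exact: intI.
  by apply: eq_Rintegral => u _;
    rewrite /levyI ReN ImN/= oppr0 !mulrN sinN mulr0 oppr0 mulN1r mulrN.
have hR : \int[mu]_(u in D) levyR (- x%:C) u = \int[mu]_(u in D) levyR x%:C u.
  by apply: eq_Rintegral => u _; rewrite /levyR ReN ImN/= oppr0 !mulrN cosN.
by apply: complexP; rewrite ?(ReJ, ImJ)/= ?hR ?hI ?(ReN, ImN)/=; ring.
Qed.

Lemma Im_levy_exp_imaginary (y : R) : Im (levy_exp (0 +i* y)) = 0.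
Proof.
rewrite /levy_exp /= mulr0 oppr0 sub0r (_ : Rintegral _ _ _ = 0) ?oppr0//.
rewrite (@eq_Rintegral _ _ _ mu _ (cst 0)) ?Rintegral_cst ?mul0r//.
by move=> u _; rewrite /levyI/= mulr0 sin0 mulr0.
Qed.

End halfplane_exponent.

(** * The mean value property in the upper half-plane *)

Section disc.
Variable R : realType.
Local Notation Re := complex.Re.
Local Notation Im := complex.Im.
Local Notation normc := ComplexField.Normc.normc.
Implicit Types (r th : R) (w : R[i]).

Definition polar r th : R[i] := (r * cos th) +i* (r * sin th).

Lemma normc_polar r th : normc (polar r th) = `|r|.
Proof.
rewrite normcE_parts/= !exprMn -mulrDr cos2Dsin2 mulr1; exact: sqrtr_sqr.
Qed.

Lemma cder_polar_radius r th : cder (polar ^~ th) r (polar 1 th).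
Proof.
split => /=.
- by apply: (is_derive_eq (derM (derid r) (dercst (cos th) r))); ring.
- by apply: (is_derive_eq (derM (derid r) (dercst (sin th) r))); ring.
Qed.

Lemma cder_polar_angle r th : cder (polar r) th ('i%C * polar r th).
Proof.
split => /=.
- apply: (is_derive_eq (derM (dercst r th) (dercos (derid th)))); ring.
- apply: (is_derive_eq (derM (dercst r th) (dersin (derid th)))); ring.
Qed.

Variables (al be : R).
Hypothesis be0 : 0 < be.

(** The conformal map of the unit disc onto the upper half-plane that sends 0
to al + i be and the unit circle to the real line, and its derivative. *)
Definition mobius (w : R[i]) : R[i] := al%:C + 'i%C * be%:C * ((1 + w) / (1 - w)).
Definition dmobius (w : R[i]) : R[i] := 'i%C * (2 * be)%:C / (1 - w) ^+ 2.

Lemma mobius0 : mobius 0 = al +i* be.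
Proof.
by rewrite /mobius addr0 subr0 divr1 mulr1; apply: complexP;
  rewrite ?(ReD, ImD, ReM, ImM)/=; ring.
Qed.

Lemma subr_neq0_disc w : normc w < 1 -> 1 - w != 0.
Proof.
by move=> w1; rewrite subr_eq0; apply/eqP => e; move: w1;
  rewrite -e ComplexField.Normc.normc1 ltxx.
Qed.

Lemma cder_mobius (g : R -> R[i]) t v : 1 - g t != 0 -> cder g t v ->
  cder (mobius \o g) t (dmobius (g t) * v).
Proof.
move=> gt0 gv.
have h1 := cderD (cder_cst 1 t) gv.
have h2 := cderV gt0 (cderB (cder_cst 1 t) gv).
have h := cderD (cder_cst al%:C t) (cderM (cder_cst ('i%C * be%:C) t) (cderM h1
  h2)).
apply: (cder_eq h); rewrite /dmobius.
rewrite (rmorphM (real_complex R)) rmorph_nat; by field.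
Qed.

(** A multiple of the Poisson kernel, which vanishes on the unit circle. *)
Lemma Im_mobius w : 1 - w != 0 ->
  Im (mobius w) = be * (1 - normc w ^+ 2) / normc (1 - w) ^+ 2.
Proof.
move=> w1; have := sqmod_gt0 w1; rewrite !normc_sqr => /lt0r_neq0.
rewrite /mobius; case: w {w1} => a b.
rewrite !(ReD, ImD, ReM, ImM, ReV, ImV, ReN, ImN)/= !sub0r => h.
by field.
Qed.

Lemma ccvg_mobius T (F : set_system T) {FF : Filter F} (g : T -> R[i]) w :
  1 - w != 0 -> ccvg F g w -> ccvg F (fun t => mobius (g t)) (mobius w).
Proof.
move=> w1 gw; apply: ccvgD; first exact: ccvg_cst.
apply: ccvgM; first exact: ccvg_cst.
apply: ccvgM; first by apply: ccvgD => //; exact: ccvg_cst.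
by apply: ccvgV => //; apply: ccvgB => //; exact: ccvg_cst.
Qed.

Lemma ccvg_dmobius T (F : set_system T) {FF : Filter F} (g : T -> R[i]) w :
  1 - w != 0 -> ccvg F g w -> ccvg F (fun t => dmobius (g t)) (dmobius w).
Proof.
move=> w1 gw; apply: ccvgM; first exact: ccvg_cst.
have c : ccvg F (fun t => 1 - g t) (1 - w) by apply: ccvgB => //; exact: ccvg_cst.
by apply: ccvgV; rewrite ?expf_neq0// expr2; exact: ccvgM.
Qed.

Lemma normc_disc_bounds (rho : R) w : rho < 1 -> normc w <= rho ->
  [/\ 1 - w != 0, 1 - rho <= normc (1 - w) & normc (1 - w) <= 2].
Proof.
move=> rho1 wr; have w1 : normc w < 1 by exact: le_lt_trans rho1.
split; first exact: subr_neq0_disc.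
- have := @le_normcD R (1 - w) w; rewrite subrK ComplexField.Normc.normc1; lra.
- have := @le_normcD R 1 (- w); rewrite normcN ComplexField.Normc.normc1; lra.
Qed.

Lemma mobius_bounds (rho : R) w : 0 <= rho < 1 -> normc w <= rho ->
  be * (1 - rho ^+ 2) / 4 <= Im (mobius w) /\
  normc (dmobius w) <= 2 * be / (1 - rho) ^+ 2.
Proof.
move=> /andP[rho0 rho1] wr.
have r2 : 0 < 1 - rho ^+ 2 by rewrite subr_gt0 expr_lt1.
have [n0 l1 l2] := normc_disc_bounds rho1 wr.
have N0 := normc_gt0 n0; have w0 := normc_ge0 w; split.
  rewrite Im_mobius// ler_pM ?mulr_ge0 ?invr_ge0 ?ler_wpM2l ?(ltW be0) ?(ltW r2)//.
    by rewrite lerB// ler_pXn2r.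
  rewrite lef_pV2 ?posrE ?exprn_gt0//.
  have -> : (4 : R) = 2 ^+ 2 by rewrite -natrX.
  by rewrite ler_pXn2r ?nnegrE// normc_ge0.
rewrite /dmobius !ComplexField.Normc.normcM ComplexField.Normc.normcV.
have -> : normc 'i%C = 1 :> R by rewrite normcE_parts/= expr0n expr1n add0r sqrtr1.
have -> : normc (2 * be)%:C = 2 * be.
  by rewrite normcE_parts/= expr0n addr0 sqrtr_sqr gtr0_norm// mulr_gt0.
rewrite mul1r ler_wpM2l ?mulr_ge0 ?(ltW be0)//.
rewrite expr2 ComplexField.Normc.normcM -expr2 lef_pV2 ?posrE ?exprn_gt0//;
  last by rewrite subr_gt0.
by rewrite ler_pXn2r ?nnegrE// ?subr_ge0 ltW.
Qed.

Lemma good_mobius (rho : R) (g v : R -> R[i]) (a b : R) : 0 <= rho < 1 ->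
  (forall t, a < t < b -> cder g t (v t)) ->
  (forall t, a < t < b -> normc (g t) <= rho /\ normc (v t) <= 1) ->
  good_curve (mobius \o g) (fun t => dmobius (g t) * v t) a b.
Proof.
move=> rho01 gv gb; have /andP[rho0 rho1] := rho01; split.
  move=> t atb; apply: cder_mobius; last exact: gv.
  by have [h _] := gb t atb; have [] := normc_disc_bounds rho1 h.
have r2 : 0 < 1 - rho ^+ 2 by rewrite subr_gt0 expr_lt1.
exists (be * (1 - rho ^+ 2) / 4); first by rewrite divr_gt0// mulr_gt0.
exists (2 * be / (1 - rho) ^+ 2) => t atb.
have [h1 h2] := gb t atb; have [Imb db] := mobius_bounds rho01 h1.
have vb : normc (dmobius (g t) * v t) <= 2 * be / (1 - rho) ^+ 2.
  rewrite -[leRHS]mulr1 ComplexField.Normc.normcM.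
  by rewrite ler_pM ?normc_ge0.
by split; [|exact: le_trans (Re_le_normc _) vb|exact: le_trans (Im_le_normc _) vb].
Qed.

Lemma Rintegral_periodic_derive (h dh : R -> R) (p : R) : 0 < p ->
  (forall x : R, is_derive x 1 h (dh x)) -> (forall x, dh y @[y --> x] --> dh x) ->
  h 0 = h p -> \int[lebesgue_measure]_(x in `[0, p]) dh x = 0.
Proof.
move=> p0 hd cdh hp; rewrite /Rintegral (@continuous_FTC2 _ dh h)//.
- by rewrite hp subee.
- by apply: continuous_subspaceT => x; exact: cdh.
- split; first by move=> x _; have [] := hd x.
  + by apply: cvg_at_right_filter; exact: (der_cvg (hd 0)).
  + by apply: cvg_at_left_filter; exact: (der_cvg (hd p)).
- by move=> x _; rewrite derive1E; have [_ ->] := hd x.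
Qed.

Lemma integrable_cst_itv (a b C : R) :
  lebesgue_measure.-integrable `[a, b] (EFin \o cst C).
Proof.
apply: continuous_compact_integrable; first exact: segment_compact.
by apply: continuous_subspaceT => x; exact: cvg_cst.
Qed.

Section mean_value.
Variables (f df : R[i] -> R[i]) (B : R).
Hypothesis fholo : holomorphic f df.
Hypothesis fB : forall z, 0 < Im z -> `|Re (f z)| <= B /\ `|Im (f z)| <= B.
Hypothesis df_bound : forall eta, 0 < eta -> exists K : R, forall z, eta <= Im z ->
  normc (df z) <= K.

Let E r th := f (mobius (polar r th)).
Let tau : R := pi *+ 2.
Let tau0 : 0 < tau. Proof. by rewrite mulrn_wgt0// pi_gt0. Qed.
Let D : set R := `[0, tau]%classic.
Let mD : measurable D. Proof. exact: measurable_itv. Qed.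

Let polar1 th : normc (polar 1 th) = 1. Proof. by rewrite normc_polar normr1. Qed.

Let good_r rho th : 0 <= rho < 1 -> good_curve (mobius \o polar ^~ th)
  (fun r => dmobius (polar r th) * polar 1 th) (- rho) rho.
Proof.
move=> h; apply: (good_mobius h) => t; first by move=> _; exact: cder_polar_radius.
by move=> tr; rewrite normc_polar polar1; split=> //; rewrite ler_norml;
  case/andP: tr => /ltW -> /ltW ->.
Qed.

Let good_th r a b : `|r| < 1 -> good_curve (mobius \o polar r)
  (fun th => dmobius (polar r th) * ('i%C * polar r th)) a b.
Proof.
move=> r1; apply: (@good_mobius `|r|); first by rewrite normr_ge0.
  by move=> t _; exact: cder_polar_angle.
move=> t _; rewrite ComplexField.Normc.normcM normc_polar.
have -> : normc 'i%C = 1 :> R by rewrite normcE_parts/= expr0n expr1n add0r sqrtr1.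
by rewrite mul1r lexx ltW.
Qed.

Let X r th := df (mobius (polar r th)) * (dmobius (polar r th) * polar 1 th).

Let dE_r r th : `|r| < 1 -> cder (E ^~ th) r (X r th).
Proof.
move=> r1; pose rho := (1 + `|r|) / 2.
have rho1 : 0 <= rho < 1 by rewrite /rho; apply/andP; have := normr_ge0 r;
  split; lra.
apply: (holo_chain fholo (good_r th rho1)).
have : `|r| < rho by rewrite /rho; lra.
by rewrite ltr_norml.
Qed.

Let itv1 (th : R) : th - 1 < th < th + 1. Proof. by apply/andP; split; lra. Qed.

(* X is the radial derivative of E; rotating it by i r gives the angular one. *)
Let XE r th : 'i%C * r%:C * X r th =
  df (mobius (polar r th)) * (dmobius (polar r th) * ('i%C * polar r th)).
Proof.
have -> : polar r th = r%:C * polar 1 th.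
  by apply: complexP; rewrite ?(ReM, ImM)/=; ring.
have -> : X r th = df (mobius (polar r th)) * (dmobius (polar r th) * polar 1
  th) by [].
have -> : polar r th = r%:C * polar 1 th.
  by apply: complexP; rewrite ?(ReM, ImM)/=; ring.
by ring.
Qed.

Let dE_th r th : `|r| < 1 -> cder (E r) th ('i%C * r%:C * X r th).
Proof.
move=> r1; rewrite XE.
exact: (holo_chain fholo (good_th (th - 1) (th + 1) r1) (itv1 th)).
Qed.

Let X_cont r th : `|r| < 1 ->
  ccvg (nbhs th) (fun t => 'i%C * r%:C * X r t) ('i%C * r%:C * X r th).
Proof.
move=> r1; rewrite XE.
have -> : (fun t => 'i%C * r%:C * X r t) =
  (fun t => df (mobius (polar r t)) * (dmobius (polar r t) * ('i%C * polar r t))).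
  by apply/funext => t; exact: XE.
have pc : ccvg (nbhs th) (polar r) (polar r th) := cder_cvg (cder_polar_angle r th).
have n1 : 1 - polar r th != 0 by apply: subr_neq0_disc; rewrite normc_polar.
apply: ccvgM;
  first exact: (holo_cont fholo (good_th (th - 1) (th + 1) r1) (itv1 th)).
apply: ccvgM; first exact: ccvg_dmobius.
by apply: ccvgM => //; exact: ccvg_cst.
Qed.

Let E_periodic r : E r 0 = E r tau.
Proof. by rewrite /E /polar /tau cos0 sin0 cos2pi sin2pi. Qed.

Let muD : lebesgue_measure D = tau%:E.
Proof. by rewrite /D lebesgue_measure_itv/= lte_fin tau0 -EFinD subr0. Qed.

Let int_cst (C : R) : lebesgue_measure.-integrable D (EFin \o cst C).
Proof. exact: integrable_cst_itv. Qed.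

Let ImE_gt0 r th : `|r| < 1 -> 0 < Im (mobius (polar r th)).
Proof.
move=> r1; have n1 : 1 - polar r th != 0 by apply: subr_neq0_disc;
  rewrite normc_polar.
rewrite Im_mobius// divr_gt0 ?exprn_gt0 ?normc_gt0// mulr_gt0// normc_polar
  subr_gt0.
by rewrite expr_lt1.
Qed.

Let ReM_le (c z : R[i]) : `|Re (c * z)| <= (`|Re c| + `|Im c|) * (`|Re z| +
  `|Im z|).
Proof.
rewrite ReM (le_trans (ler_normB _ _))// !normrM mulrDl !mulrDr.
have := mulr_ge0 (normr_ge0 (Re c)) (normr_ge0 (Im z)).
have := mulr_ge0 (normr_ge0 (Im c)) (normr_ge0 (Re z)); lra.
Qed.

Let dReM c (g : R -> R[i]) t v : cder g t v ->
  is_derive t 1 (fun s => Re (c * g s)) (Re (c * v)).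
Proof. by move=> gv; have [+ _] := cderM (cder_cst c t) gv;
  rewrite mul0r add0r. Qed.

Let dImM c (g : R -> R[i]) t v : cder g t v ->
  is_derive t 1 (fun s => Im (c * g s)) (Im (c * v)).
Proof. by move=> gv; have [_ +] := cderM (cder_cst c t) gv;
  rewrite mul0r add0r. Qed.

Lemma integrable_circle (c : R[i]) r : `|r| < 1 ->
  lebesgue_measure.-integrable D (EFin \o (fun th => Re (c * E r th))).
Proof.
move=> r1.
apply: (@dominated_integrable_EFin R _ _ lebesgue_measure D mD _
  (cst ((`|Re c| + `|Im c|) * (B + B)))); [|exact: int_cst|].
  by apply: der_measurable => th; eexists; exact: dReM (dE_th th r1).
move=> th _; have [b1 b2] := fB (ImE_gt0 th r1).
by rewrite (le_trans (ReM_le _ _))// ler_wpM2l ?addr_ge0// lerD.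
Qed.

(** The mean over the circle of radius r does not depend on r: the chain rule
gives r d/dr = - i d/dtheta, and the integral of the angular derivative over a
full period vanishes. The factor c extracts any real linear functional. *)
Lemma mean_value (c : R[i]) r : 0 <= r < 1 ->
  \int[lebesgue_measure]_(th in D) Re (c * E r th) = tau * Re (c * f (al +i* be)).
Proof.
move=> /andP[r0 r1].
pose F s := \int[lebesgue_measure]_(th in D) Re (c * E s th).
have F0 : F 0 = tau * Re (c * f (al +i* be)).
  rewrite /F (@eq_Rintegral _ _ _ _ _ (cst (Re (c * f (al +i* be))))).
    rewrite Rintegral_cst// mulrC; congr (_ * _); exact: (congr1 fine muD).
  move=> th _; rewrite /E /= -mobius0; congr (Re (c * f (mobius _))).
  by apply: complexP; rewrite /= mul0r.
have dF (s : R) : `|s| < 1 -> is_derive s 1 F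
    (\int[lebesgue_measure]_(th in D) Re (c * X s th)).
  (* the derivative is bounded on the disc of radius rho, as rho < 1 *)
  move=> s1; pose rho := (1 + `|s|) / 2.
  have n0 := normr_ge0 s.
  have rho1 : 0 <= rho < 1 by rewrite /rho; apply/andP; split; lra.
  have srho : - rho < s < rho by rewrite -ltr_norml /rho; lra.
  have lt1 u : - rho < u < rho -> `|u| < 1.
    by rewrite -ltr_norml => /lt_trans; apply; case/andP: rho1.
  have r2 : 0 < 1 - rho ^+ 2 by case/andP: rho1 => rho0 rho1;
    rewrite subr_gt0 expr_lt1.
  have eta0 : 0 < be * (1 - rho ^+ 2) / 4 by rewrite divr_gt0// mulr_gt0.
  have [K HK] := df_bound eta0.
  pose M := 2 * be / (1 - rho) ^+ 2.
  have XB u th : - rho < u < rho -> `|Re (c * X u th)| <= normc c * (K * M).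
    rewrite -ltr_norml => /ltW; rewrite -(normc_polar u th) => hu.
    have [h1 h2] := mobius_bounds rho1 hu.
    rewrite (le_trans (Re_le_normc _))// ComplexField.Normc.normcM.
    rewrite (ComplexField.Normc.normcM (df _)) (ComplexField.Normc.normcM
      (dmobius _)).
    rewrite ler_wpM2l ?normc_ge0// ler_pM ?mulr_ge0 ?normc_ge0//; first exact: HK.
    by rewrite polar1 mulr1; exact: h2.
  apply: (@is_derive_Rintegral R _ _ lebesgue_measure D mD (fun u th => Re (c *
    E u th))
    (fun u th => Re (c * X u th)) (cst (normc c * (K * M))) _ _ _ srho).
  - by move=> u hu; apply: integrable_circle; exact: lt1.
  - by move=> u th hu _; apply: dReM; apply: dE_r; exact: lt1.
  - exact: int_cst.
  - by move=> u th hu _; exact: XB.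
have dF0 (s : R) : 0 < s < 1 -> \int[lebesgue_measure]_(th in D) Re (c * X s
  th) = 0.
  move=> /andP[s0 s1]; have s1' : `|s| < 1 by rewrite gtr0_norm.
  have := @Rintegral_periodic_derive (fun th => Im (c * E s th))
    (fun th => Im (c * ('i%C * s%:C * X s th))) tau tau0
    (fun th => dImM c (dE_th th s1')) _ _.
  have cX (th : R) : Im (c * ('i%C * s%:C * X s t)) @[t --> th] -->
      Im (c * ('i%C * s%:C * X s th)).
    by have [] := ccvgM (ccvg_cst c) (X_cont th s1').
  move=> /(_ cX); rewrite E_periodic => /(_ erefl) I0.
  have iX : lebesgue_measure.-integrable D
      (EFin \o (fun th => Im (c * ('i%C * s%:C * X s th)))).
    apply: continuous_compact_integrable; first exact: segment_compact.
    by apply: continuous_subspaceT => th; exact: cX.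
  rewrite -[RHS](mulr0 s^-1) -I0 -RintegralZl//.
  apply: eq_Rintegral => th _.
  have -> : Im (c * ('i%C * s%:C * X s th)) = s * Re (c * X s th).
    by move: (X s th) => Y; rewrite !(ReM, ImM)/=; ring.
  by rewrite mulKf// gt_eqF.
rewrite -F0; have [->//|rn0] := eqVneq r 0.
have r0' : 0 < r by rewrite lt_neqAle eq_sym rn0.
have dFr (s : R) : s \in `]0, r[ -> is_derive s 1 F 0.
  rewrite in_itv/= => /andP[s0 sr]; have s1 := lt_trans sr r1.
  by rewrite -(dF0 s) ?s0//; apply: dF; rewrite gtr0_norm.
have cF : {within `[0, r], continuous F}.
  apply: derivable_within_continuous => s; rewrite in_itv/= => /andP[s0 sr].
  have s1 : `|s| < 1 by rewrite ger0_norm// (le_lt_trans sr).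
  by have [] := dF s s1.
have [u _] := MVT r0' dFr cF.
by rewrite mul0r => /eqP; rewrite subr_eq0 => /eqP.
Qed.

End mean_value.
End disc.

(** * A bounded holomorphic function attached to two exponents *)

Section bounded_function.
Variable R : realType.
Local Notation Re := complex.Re.
Local Notation Im := complex.Im.
Local Notation normc := ComplexField.Normc.normc.

(** What the uniqueness argument uses of a subordinator exponent that does not
vanish identically on the real line. *)
Record halfplane_exponent (k dk : R[i] -> R[i]) : Prop := Exponent {
  exp_holo : holomorphic k dk ;
  exp_dbound : forall eta, 0 < eta -> exists K : R, forall z, eta <= Im z ->
    normc (dk z) <= K ;
  exp_cvg : forall u z, (forall n, 0 <= Im (u n)) -> ccvg \oo u z ->
    ccvg \oo (k \o u) (k z) ;
  exp_Re_ge0 : forall z, 0 <= Im z -> 0 <= Re (k z) ;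
  exp_Re_gt0 : forall eta, 0 < eta -> exists2 b : R, 0 < b &
    forall z, eta <= Im z -> b <= Re (k z) ;
  exp_conj : forall x : R, k (- x%:C) = (k x%:C)^* ;
  exp_imag : forall y : R, Im (k (0 +i* y)) = 0 ;
  exp_zeros : countable [set x : R | k x%:C = 0] }.

Lemma halfplane_exponent_of_subordinator k : is_subordinator_exponent k ->
  (exists x : R, k x%:C != 0) ->
  exists k' dk, halfplane_exponent k' dk /\ forall z, 0 <= Im z -> k z = k' z.
Proof.
move=> [q [delta [mu [q0 d0 fin hk]]]] [x kx].
exists (levy_exp q delta mu), (dlevy_exp delta mu).
have E z : 0 <= Im z -> k z = levy_exp q delta mu z.
  move=> z0; rewrite -[k z]opprK hk// /cintegral.
  have -> : \int[mu]_(x in `]0%R, +oo[) Re (cexp ('i%C * x%:C * z) - 1) =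
      \int[mu]_(x in `]0%R, +oo[) levyR z x.
    by apply: eq_Rintegral => u _; rewrite levyE.
  have -> : \int[mu]_(x in `]0%R, +oo[) Im (cexp ('i%C * x%:C * z) - 1) =
      \int[mu]_(x in `]0%R, +oo[) levyI z x.
    by apply: eq_Rintegral => u _; rewrite levyE.
  by apply: complexP; rewrite /levy_exp ?(ReN, ImN, ReD, ImD, ReM, ImM)/=; ring.
have kx' : levy_exp q delta mu x%:C != 0 by rewrite -E/=.
split; last exact: E.
split.
- exact: holomorphic_levy_exp.
- exact: dlevy_exp_bound.
- exact: levy_exp_cvg.
- exact: Re_levy_exp_ge0.
- move=> eta eta0; exists (Re (levy_exp q delta mu (0 +i* eta)));
  first exact: Re_levy_exp_gt0 kx' _ eta0.
  by move=> z hz; apply: Re_levy_exp_mono; rewrite // (ltW eta0).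
- exact: levy_expJ.
- exact: Im_levy_exp_imaginary.
- exact: countable_levy_exp_zeros kx'.
Qed.

Lemma Re_halfplane_exponent_gt0 k dk z : halfplane_exponent k dk -> 0 < Im z ->
  0 < Re (k z).
Proof. by move=> ke z0; have [b b0 h] := exp_Re_gt0 ke z0;
  exact: lt_le_trans (h z (lexx _)). Qed.

(** Depends on s / t only, and maps the right half-plane of values of s / t
into the unit disc. *)
Definition cayley (s t : R[i]) : R[i] := (s - t) / (s + t).

(** Two points of the sector of half-angle pi / 4 have a quotient of nonnegative
real part. *)
Lemma normc_cayley (s t : R[i]) : `|Im s| <= Re s -> `|Im t| <= Re t ->
  normc (cayley s t) <= 1.
Proof.
move=> hs ht; have [st0|st0] := eqVneq (s + t) 0.
  by rewrite /cayley st0 invr0 mulr0 ComplexField.Normc.normc0.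
rewrite /cayley ComplexField.Normc.normcM ComplexField.Normc.normcV.
rewrite ler_pdivrMr ?normc_gt0// mul1r -ler_sqr ?nnegrE ?normc_ge0//.
rewrite !normc_sqr !(ReD, ImD, ReN, ImN) -subr_ge0.
have h : 0 <= Re s * Re t + Im s * Im t.
  have : `|Im s * Im t| <= Re s * Re t by rewrite normrM ler_pM.
  by rewrite ler_norml => /andP[]; lra.
rewrite (_ : _ - _ = 4 * (Re s * Re t + Im s * Im t)) ?mulr_ge0//; ring.
Qed.

Section pair.
Variables (k1 dk1 k2 dk2 : R[i] -> R[i]).
Hypotheses (e1 : halfplane_exponent k1 dk1) (e2 : halfplane_exponent k2 dk2).

Let s1 z := csqrt (k1 z).
Let s2 z := csqrt (k2 z).
(** The bounded holomorphic function attached to a pair of exponents. It is a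
Moebius function of sqrt (k1 / k2), written so as to be bounded whatever the
zeros of k1 and k2. *)
Definition sqrt_cayley z := cayley (csqrt (k1 z)) (csqrt (k2 z)).
Let ds1 z := dk1 z / (2 * s1 z).
Let ds2 z := dk2 z / (2 * s2 z).
Definition dsqrt_cayley z := (ds1 z - ds2 z - sqrt_cayley z * (ds1 z + ds2 z))
  / (s1 z + s2 z).

Lemma normc_sqrt_cayley z : 0 <= Im z -> normc (sqrt_cayley z) <= 1.
Proof. by move=> z0; apply: normc_cayley; apply: csqrt_sector;
  [exact: exp_Re_ge0 e1 _ z0|exact: exp_Re_ge0 e2 _ z0]. Qed.

Lemma csqrt_sum_neq0 (u v : R[i]) : 0 <= Re u -> 0 <= Re v -> u != 0 -> csqrt u
  + csqrt v != 0.
Proof.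
move=> u0 v0 un0; apply/eqP => e.
have h := Re_csqrt_ge0 u; have h' := Re_csqrt_ge0 v.
have e' : Re (csqrt u) + Re (csqrt v) = 0 by rewrite -ReD e.
have r0 : Re (csqrt u) = 0 by lra.
have := csqrt_sector u0; rewrite r0 normr_le0 => /eqP i0.
move: un0; rewrite -(csqrtK u0) (_ : csqrt u = 0) ?expr0n ?eqxx//.
exact: complexP.
Qed.

Let sn0 (k dk : R[i] -> R[i]) (z : R[i]) : halfplane_exponent k dk -> 0 < Im z
  -> csqrt (k z) != 0 /\ k z != 0.
Proof.
move=> ke z0; have := Re_halfplane_exponent_gt0 ke z0 => k0.
have kn0 : k z != 0 by apply/eqP => e; move: k0; rewrite e ltxx.
by rewrite csqrt_eq0 ?ltW.
Qed.

Let good_gt0 (g v : R -> R[i]) a b t : good_curve g v a b -> a < t < b -> 0 <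
  Im (g t).
Proof. by move=> [_ [eta eta0 [M h]]] /h[+ _ _]; exact: lt_le_trans. Qed.

Let near_itv (a b t : R) : a < t < b -> \forall s \near t, a < s < b.
Proof.
move=> atb; have : t \in `]a, b[ by rewrite in_itv.
by move/near_in_itvoo; apply: filterS => s /=; rewrite in_itv.
Qed.

Let holo_sqrt k dk : halfplane_exponent k dk ->
  holomorphic (fun z => csqrt (k z)) (fun z => dk z / (2 * csqrt (k z))).
Proof.
move=> ke; split => g v a b t gg atb; have [n0 k0] := sn0 ke (good_gt0 gg atb).
  have h := holo_chain (exp_holo ke) gg atb.
  have near0 : \forall s \near t, 0 <= Re ((k \o g) s).
    by apply: filterS (near_itv atb) => s hs;
      exact: ltW (Re_halfplane_exponent_gt0 ke (good_gt0 gg hs)).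
  by apply: (cder_eq (cder_csqrt near0 k0 h)); rewrite /= mulrAC.
apply: ccvgM; first exact: (holo_cont (exp_holo ke) gg atb).
apply: ccvgV; first by rewrite mulf_neq0// pnatr_eq0.
apply: ccvgM; first exact: ccvg_cst.
apply: ccvg_csqrt => //;
  first exact: ltW (Re_halfplane_exponent_gt0 ke (good_gt0 gg atb)).
exact: (cder_cvg (holo_chain (exp_holo ke) gg atb)).
Qed.

Lemma holo_sqrt_cayley : holomorphic sqrt_cayley dsqrt_cayley.
Proof.
have h1 := holo_sqrt e1; have h2 := holo_sqrt e2.
have st z : 0 < Im z -> s1 z + s2 z != 0.
  move=> z0; have [_ n0] := sn0 e1 z0.
  by apply: csqrt_sum_neq0 => //; apply: ltW;
    [exact: Re_halfplane_exponent_gt0 e1 z0|exact: Re_halfplane_exponent_gt0 e2 z0].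
split => g v a b t gg atb; have z0 := good_gt0 gg atb; have stz := st _ z0.
  have d1 := holo_chain h1 gg atb; have d2 := holo_chain h2 gg atb.
  apply: (cder_eq (cderM (cderB d1 d2) (cderV stz (cderD d1 d2)))).
  rewrite /dsqrt_cayley /sqrt_cayley /cayley -/(s1 _) -/(s2 _) -/(ds1 _) -/(ds2
    _) /=.
  rewrite -/(s1 _) -/(s2 _) in stz *.
  by field.
have c1 := holo_cont h1 gg atb; have c2 := holo_cont h2 gg atb.
have k1c := cder_cvg (holo_chain h1 gg atb).
have k2c := cder_cvg (holo_chain h2 gg atb).
have sV : ccvg (nbhs t) (fun x => (s1 (g x) + s2 (g x))^-1) (s1 (g t) + s2 (g
  t))^-1.
  by apply: ccvgV => //; exact: ccvgD.
apply: ccvgM => //; apply: ccvgB; first exact: ccvgB.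
apply: ccvgM; last exact: ccvgD.
by apply: ccvgM => //; exact: ccvgB.
Qed.

(** Far from the real line the derivatives of the exponents are bounded and
their square roots are bounded away from 0. *)
Lemma dsqrt_cayley_bound eta : 0 < eta -> exists K : R, forall z, eta <= Im z ->
  normc (dsqrt_cayley z) <= K.
Proof.
move=> eta0.
have [K1 H1] := exp_dbound e1 eta0; have [K2 H2] := exp_dbound e2 eta0.
have [b1 b10 B1] := exp_Re_gt0 e1 eta0; have [b2 b20 B2] := exp_Re_gt0 e2 eta0.
pose r1 := Num.sqrt b1; pose r2 := Num.sqrt b2.
have sl (k : R[i] -> R[i]) (b : R) (z : R[i]) : 0 < b -> b <= Re (k z) ->
  Num.sqrt b <= Re (csqrt (k z)).
  move=> b0 bk; rewrite -[leRHS]ger0_norm ?Re_csqrt_ge0// -sqrtr_sqr ler_wsqrtr//.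
  have k0 : 0 <= Re (k z) by rewrite (le_trans _ bk)// ltW.
  have := congr1 (@complex.Re R) (csqrtK k0); rewrite expr2 ReM -!expr2 => e.
  by have := sqr_ge0 (Im (csqrt (k z))); lra.
have dsb (k dk : R[i] -> R[i]) (b K : R) (z : R[i]) : halfplane_exponent k dk
  -> 0 < b -> b <= Re (k z) -> normc (dk z) <= K ->
    normc (dk z / (2 * csqrt (k z))) <= K / (2 * Num.sqrt b).
  move=> ke b0 bk hK; rewrite ComplexField.Normc.normcM ComplexField.Normc.normcV.
  have p0 : 0 < Num.sqrt b by rewrite sqrtr_gt0.
  have l : 2 * Num.sqrt b <= normc (2 * csqrt (k z)).
    rewrite ComplexField.Normc.normcM.
    have -> : normc 2 = 2 :> R.
      by rewrite normcE_parts/= addr0 expr0n addr0 sqrtr_sqr ger0_norm.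
    rewrite ler_wpM2l// (le_trans (sl _ _ _ b0 bk))//.
    exact: le_trans (ler_norm _) (Re_le_normc _).
  rewrite ler_pM ?normc_ge0 ?invr_ge0 ?normc_ge0// lef_pV2 ?posrE ?mulr_gt0//.
  by rewrite (lt_le_trans _ l)// mulr_gt0.
exists ((K1 / (2 * r1) + K2 / (2 * r2) + 1 * (K1 / (2 * r1) + K2 / (2 * r2))) /
  r1) => z hz.
have z0 := lt_le_trans eta0 hz.
have D1 := dsb _ _ _ _ _ e1 b10 (B1 z hz) (H1 z hz).
have D2 := dsb _ _ _ _ _ e2 b20 (B2 z hz) (H2 z hz).
have W1 := normc_sqrt_cayley (ltW z0).
have S : r1 <= normc (s1 z + s2 z).
  rewrite (le_trans _ (Re_le_normc _))// (le_trans _ (ler_norm _))// ReD.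
  by rewrite (le_trans (sl _ _ _ b10 (B1 z hz)))// lerDl Re_csqrt_ge0.
have r10 : 0 < r1 by rewrite sqrtr_gt0.
rewrite ComplexField.Normc.normcM ComplexField.Normc.normcV.
rewrite ler_pM ?normc_ge0 ?invr_ge0 ?normc_ge0//; last first.
  by rewrite lef_pV2 ?posrE// (lt_le_trans r10 S).
have sumb : normc (ds1 z + ds2 z) <= K1 / (2 * r1) + K2 / (2 * r2).
  by rewrite (le_trans (le_normcD _ _))// lerD.
rewrite (le_trans (le_normcD _ _))// lerD//.
  by rewrite (le_trans (le_normcD _ _))// normcN lerD.
by rewrite normcN ComplexField.Normc.normcM ler_pM ?normc_ge0.
Qed.

Lemma sqrt_cayley_cvg u z : (forall n, 0 <= Im (u n)) -> 0 <= Im z -> ccvg \oo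
  u z ->
  k1 z != 0 -> k2 z != 0 -> ccvg \oo (sqrt_cayley \o u) (sqrt_cayley z).
Proof.
move=> u0 z0 uz k1n k2n.
have r1 := exp_Re_ge0 e1 z0; have r2 := exp_Re_ge0 e2 z0.
have c1 : ccvg \oo (fun n => csqrt (k1 (u n))) (csqrt (k1 z)).
  exact: ccvg_csqrt r1 k1n (exp_cvg e1 u0 uz).
have c2 : ccvg \oo (fun n => csqrt (k2 (u n))) (csqrt (k2 z)).
  exact: ccvg_csqrt r2 k2n (exp_cvg e2 u0 uz).
have n0 := csqrt_sum_neq0 r1 r2 k1n.
exact: (ccvgM (ccvgB c1 c2) (ccvgV n0 (ccvgD c1 c2))).
Qed.

End pair.
End bounded_function.

(** * Square roots and boundary values *)

Section boundary.
Variable R : realType.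
Local Notation Re := complex.Re.
Local Notation Im := complex.Im.
Local Notation normc := ComplexField.Normc.normc.

(** |E exp(i z X_t)| is bounded in t, whereas exp(- t Re (psi z)) would be
unbounded in t if Re (psi z) were negative. *)
Lemma Re_levy_exponent_ge0 (d : measure_display) (Omega : measurableType d)
    (P : probability Omega R) (X : R -> {RV P >-> R}) (psi : R -> R[i]) (z : R) :
  is_levy_exponent X psi -> 0 <= Re (psi z).
Proof.
move=> hpsi; rewrite leNgt; apply/negP => neg.
pose t := 2 / - Re (psi z).
have t0 : 0 <= t by rewrite divr_ge0// oppr_ge0 ltW.
have := hpsi t z t0; set I := cintegral _ _ _ => e.
have PT : (P [set: Omega] < +oo)%E by rewrite probability_setT ltry.
have bnd (g : R -> R) : measurable_fun [set: R] g -> (forall x, `|g x| <= 1) ->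
    `|\int[P]_(w in [set: Omega]) g (z * X t w)| <= 1.
  move=> mg g1.
  have mgX : measurable_fun [set: Omega] (fun w => g (z * X t w)).
    by apply: measurableT_comp => //; exact: measurable_funM.
  have int1 : P.-integrable [set: Omega] (EFin \o cst (1 : R)).
    by apply: finite_measure_integrable_cst.
  have ig : P.-integrable [set: Omega] (EFin \o (fun w => g (z * X t w))).
    exact: (dominated_integrable_EFin measurableT mgX int1 (fun w _ => g1 _)).
  rewrite (le_trans (le_normr_Rintegral measurableT ig))//.
  apply: (@le_trans _ _ (\int[P]_(w in [set: Omega]) cst 1 w)).
    by apply: le_Rintegral => //; exact: (integrable_abse ig).
  rewrite Rintegral_cst// mul1r (_ : fine _ = 1)//.
  exact: (congr1 fine (probability_setT P)).
have mcos : measurable_fun [set: R] (@cos R).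
  by apply: continuous_measurable_fun; exact: continuous_cos.
have msin : measurable_fun [set: R] (@sin R).
  by apply: continuous_measurable_fun; exact: continuous_sin.
have expE (x : R) : cexp ('i%C * x%:C) = cos x +i* sin x.
  have -> : 'i%C * x%:C = 0 +i* x by apply: complexP; rewrite ?(ReM, ImM)/=; ring.
  by rewrite /cexp/= expR0 !mul1r.
have IE : I = (\int[P]_(w in [set: Omega]) cos (z * X t w))
   +i* (\int[P]_(w in [set: Omega]) sin (z * X t w)).
  by rewrite /I /cintegral; congr (_ +i* _); apply: eq_Rintegral => w _;
    rewrite expE.
have I2 : normc I <= 2.
  rewrite (le_trans (normc_leD _))// IE/=.
  by have := bnd _ mcos (@cos_max R); have := bnd _ msin (@sin_max R); lra.
move: I2; rewrite e; apply/negP; rewrite -ltNge.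
have -> : normc (cexp (- (t%:C * psi z))) = expR (Re (- (t%:C * psi z))).
  rewrite /cexp normcE_parts/= !exprMn -mulrDr cos2Dsin2 mulr1 sqrtr_sqr.
  by rewrite ger0_norm ?expR_ge0.
have -> : Re (- (t%:C * psi z)) = 2.
  by rewrite ReN ReM/= mul0r subr0 /t; field; rewrite lt_eqF.
by have := @expR_ge1Dx R 2; lra.
Qed.

Lemma cos_eq1_itv (t : R) : 0 <= t < pi *+ 2 -> cos t = 1 -> t = 0.
Proof.
move=> /andP[t0 t2] ct; have [tp|tp] := leP t pi.
  apply: (@cos_inj R); rewrite ?in_itv/= ?lexx ?pi_ge0 ?t0 ?tp//.
  by rewrite cos0.
suff : pi *+ 2 - t = 0 by move=> e; move: t2; rewrite -subr_gt0 e ltxx.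
apply: (@cos_inj R); rewrite ?in_itv/= ?lexx ?pi_ge0//.
  by apply/andP; split; rewrite ?subr_ge0 ?(ltW t2)//; move: tp;
    rewrite mulr2n; lra.
by rewrite cos0 cosB cos2pi sin2pi mul0r addr0 mul1r.
Qed.

Lemma polar1_inj (s t : R) : 0 <= s < pi *+ 2 -> 0 <= t < pi *+ 2 ->
  polar 1 s = polar 1 t -> s = t.
Proof.
wlog st : s t / t <= s => [h|] s0 t0 e.
  have [ts|/ltW st] := leP t s; first exact: h.
  by apply/esym/h.
move: e; rewrite /polar !mul1r => -[c s'].
apply/eqP; rewrite -subr_eq0; apply/eqP/cos_eq1_itv.
  by rewrite subr_ge0 st/=; case/andP: s0 => _; case/andP: t0; lra.
by rewrite cosB c s' -!expr2 cos2Dsin2.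
Qed.

Lemma mobius_inj (al be : R) (v w : R[i]) : 0 < be -> 1 - v != 0 -> 1 - w != 0 ->
  mobius al be v = mobius al be w -> v = w.
Proof.
move=> be0 v1 w1; rewrite /mobius => /addrI.
have ib : 'i%C * be%:C != 0 :> R[i].
  apply/eqP => /(congr1 (@complex.Im R)); rewrite ImM/= !mul0r mul1r add0r.
  by move=> e; move: be0; rewrite e ltxx.
move=> /(mulfI ib) /eqP; rewrite eqr_div// => /eqP h.
apply/eqP; rewrite -subr_eq0; apply/eqP.
have : 2 * (v - w) = (1 + v) * (1 - w) - (1 + w) * (1 - v) by ring.
by rewrite h subrr => /eqP; rewrite mulf_eq0 pnatr_eq0 => /eqP.
Qed.

Lemma cayley_eqP (s t S T : R[i]) : s + t != 0 -> S + T != 0 ->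
  (cayley s t = cayley S T) <-> s * T = t * S.
Proof.
move=> st ST; rewrite /cayley; split.
  move=> /eqP; rewrite eqr_div// => /eqP h.
  have : 2 * (s * T - t * S) = (s - t) * (S + T) - (S - T) * (s + t) by ring.
  rewrite h subrr => /eqP; rewrite mulf_eq0 pnatr_eq0 subr_eq0 => /eqP.
  exact.
move=> h; apply/eqP; rewrite eqr_div//; apply/eqP.
have : (s - t) * (S + T) - (S - T) * (s + t) = 2 * (s * T - t * S) by ring.
by rewrite h subrr mulr0 => /eqP; rewrite subr_eq0 => /eqP.
Qed.

(** Both sides are square roots of a * b with nonnegative real part, so they
can only be opposite if they are imaginary; then a * b is a nonpositive real,
hence 0. This is where the real part of a Levy exponent being nonnegative
excludes a jump of the argument by 2 pi. *)
Lemma csqrt_factor (a b c d : R[i]) : 0 <= Re a -> 0 <= Re b -> 0 <= Re c ->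
  0 <= Re d -> 0 <= Re (a * b) -> a * b = c * d ->
  csqrt a * csqrt b = csqrt c * csqrt d.
Proof.
move=> a0 b0 c0 d0 ab0 abcd.
have Rege (u v : R[i]) : 0 <= Re u -> 0 <= Re v -> 0 <= Re (csqrt u * csqrt v).
  move=> u0 v0; rewrite ReM subr_ge0 (le_trans (ler_norm _))// normrM.
  by rewrite ler_pM ?csqrt_sector.
have r1 := Rege _ _ a0 b0; have r2 := Rege _ _ c0 d0.
have sq : (csqrt a * csqrt b) ^+ 2 = (csqrt c * csqrt d) ^+ 2.
  by rewrite !exprMn !csqrtK.
have /eqP := sq; rewrite eqf_sqr => /orP[/eqP//|/eqP e].
have r10 : Re (csqrt a * csqrt b) = 0.
  by apply/eqP; rewrite eq_le r1 andbT e ReN oppr_le0.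
have i10 : Im (csqrt a * csqrt b) = 0.
  have : Re (a * b) = Re ((csqrt a * csqrt b) ^+ 2) by rewrite exprMn !csqrtK.
  rewrite expr2 [RHS]ReM r10 mul0r sub0r -expr2 => h.
  move: ab0; rewrite h oppr_ge0 => s0; apply/eqP.
  by rewrite -sqrf_eq0 eq_le s0 sqr_ge0.
have z0 : csqrt a * csqrt b = 0 by exact: complexP.
by move: e; rewrite z0 => /eqP; rewrite eq_sym oppr_eq0 => /eqP ->.
Qed.

End boundary.

(** * Uniqueness of the factorization *)

Section factorization_unique.
Variable R : realType.
Local Notation Re := complex.Re.
Local Notation Im := complex.Im.
Local Notation normc := ComplexField.Normc.normc.
Variables (k1 dk1 k2 dk2 k3 dk3 k4 dk4 : R[i] -> R[i]).
Hypotheses (e1 : halfplane_exponent k1 dk1) (e2 : halfplane_exponent k2 dk2)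
  (e3 : halfplane_exponent k3 dk3) (e4 : halfplane_exponent k4 dk4).
Hypothesis Re_ge0 : forall x : R, 0 <= Re (k1 x%:C * k4 (- x%:C)).
Hypothesis fact : forall x : R, k1 x%:C * k4 (- x%:C) = k2 x%:C * k3 (- x%:C).

Let f := sqrt_cayley k1 k2.
Let g := sqrt_cayley k3 k4.

Lemma countableU (A B : set R) : countable A -> countable B -> countable (A `|` B).
Proof.
by move=> cA cB; rewrite -bigcup2E; apply: bigcup_countable => // -[|[|i]].
Qed.

Lemma conjD (z u : R[i]) : (z + u)^* = z^* + u^*.
Proof. exact: rmorphD. Qed.

(** Conjugation replaces x by - x in k3 and k4, and the Cayley transform is
determined by a quotient; so the claim amounts to the equality of
sqrt (k1 x) * sqrt (k4 (- x)) and sqrt (k2 x) * sqrt (k3 (- x)), which is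
[csqrt_factor]. *)
Lemma boundary_conj (x : R) : k1 x%:C != 0 -> k3 x%:C != 0 ->
  g x%:C = (f x%:C)^*.
Proof.
move=> k1n k3n.
have r (k dk : R[i] -> R[i]) (y : R) : halfplane_exponent k dk -> 0 <= Re (k
  y%:C) by move=> ke; apply: (exp_Re_ge0 ke); exact: lexx.
have rN (k dk : R[i] -> R[i]) (y : R) : halfplane_exponent k dk -> 0 <= Re (k
  (- y%:C)).
  by move=> ke; rewrite (exp_conj ke) ReJ; exact: r ke.
have sqE : csqrt (k1 x%:C) * csqrt (k4 (- x%:C)) = csqrt (k2 x%:C) * csqrt (k3
  (- x%:C)).
  apply: csqrt_factor => //; [exact: r e1|exact: rN e4|exact: r e2|exact: rN e3].
rewrite /f /g /sqrt_cayley; move: sqE;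
  rewrite (exp_conj e4) (exp_conj e3) !csqrtJ => sqE.
have n12 : csqrt (k1 x%:C) + csqrt (k2 x%:C) != 0.
  by apply: csqrt_sum_neq0 => //; [exact: r e1|exact: r e2].
have n34 : csqrt (k3 x%:C) + csqrt (k4 x%:C) != 0.
  by apply: csqrt_sum_neq0 => //; [exact: r e3|exact: r e4].
have -> : (cayley (csqrt (k1 x%:C)) (csqrt (k2 x%:C)))^* =
    cayley ((csqrt (k1 x%:C))^*) ((csqrt (k2 x%:C))^*).
  by rewrite /cayley fmorph_div rmorphB rmorphD.
have n12' : (csqrt (k1 x%:C))^* + (csqrt (k2 x%:C))^* != 0.
  by rewrite -conjD conjc_eq0.
apply/(cayley_eqP n34 n12').
have := congr1 (@complex.Im R) sqE; have := congr1 (@complex.Re R) sqE.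
rewrite !(ReM, ImM, ReJ, ImJ) => hR hI.
by apply: complexP; rewrite !(ReM, ImM, ReJ, ImJ); lra.
Qed.

Section at_point.
Variables (al be : R).
Hypothesis be0 : 0 < be.

Let tau : R := pi *+ 2.
Let D : set R := `[0, tau]%classic.
Let mD : measurable D. Proof. exact: measurable_itv. Qed.
Let tau0 : 0 < tau. Proof. by rewrite mulrn_wgt0// pi_gt0. Qed.
Let rad (n : nat) : R := n%:R / n.+1%:R.

Let rad01 n : 0 <= rad n < 1.
Proof. by rewrite /rad divr_ge0//= ltr_pdivrMr// mul1r ltr_nat. Qed.

Let rad_lt1 n : `|rad n| < 1.
Proof. by have /andP[h1 h2] := rad01 n; rewrite ger0_norm. Qed.

Let cvg_rad : rad n @[n --> \oo] --> (1 : R).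
Proof.
have -> : rad = fun n => 1 - n.+1%:R^-1.
  apply/funext => n; rewrite /rad -[X in X / _](addrK 1) natr1 mulrBl.
  by rewrite divff ?pnatr_eq0// div1r.
rewrite -[X in _ --> X]subr0; apply: cvgB; first exact: cvg_cst.
exact: cvg_harmonic.
Qed.

Let cvg_polar th : ccvg \oo (fun n => polar (rad n) th) (polar 1 th).
Proof. by split=> /=; (apply: cvgM; [exact: cvg_rad|exact: cvg_cst]). Qed.

(* The points of the real line at which f or g may fail to be continuous. *)
Let Z : set R := [set x : R | k1 x%:C = 0] `|` [set x : R | k2 x%:C = 0]
  `|` [set x : R | k3 x%:C = 0] `|` [set x : R | k4 x%:C = 0].

Let mb th := mobius al be (polar 1 th).

Let n1 th : 0 < th < tau -> 1 - polar 1 th != 0.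
Proof.
move=> /andP[th0 tht]; rewrite subr_eq0; apply/eqP => h.
have : th = 0.
  apply: polar1_inj; rewrite ?lexx ?tau0 ?(ltW th0)//=.
  by rewrite -h /polar !mul1r cos0 sin0.
by move=> e; move: th0; rewrite e ltxx.
Qed.

Let mb_real th : 0 < th < tau -> mb th = (Re (mb th))%:C.
Proof.
move=> tht; apply: complexP; first by [].
rewrite /mb Im_mobius; last exact: n1.
by rewrite normc_polar normr1 expr1n subrr mulr0 mul0r.
Qed.

Let N : set R := [set 0; tau] `|` [set th | 0 < th < tau /\ Z (Re (mb th))].

Let cN : countable N.
Proof.
have cZ : countable Z.
  apply: countableU; last exact: exp_zeros e4.
  apply: countableU; last exact: exp_zeros e3.
  by apply: countableU; [exact: exp_zeros e1|exact: exp_zeros e2].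
apply: countableU; first by apply: finite_set_countable; exact: finite_set2.
have /countable_injP[h hinj] := cZ.
apply/countable_injP; exists (fun th => h (Re (mb th))).
move=> s t /set_mem[s0 Zs] /set_mem[t0 Zt] /= hst.
have e : Re (mb s) = Re (mb t) by apply: hinj => //; exact: mem_set.
have : mb s = mb t by rewrite mb_real// [RHS]mb_real// e.
move/(mobius_inj be0 (n1 s0) (n1 t0)); apply: polar1_inj.
- by case/andP: s0 => /ltW -> ->.
- by case/andP: t0 => /ltW -> ->.
Qed.

Let Im_ge0 n th : 0 <= Im (mobius al be (polar (rad n) th)).
Proof.
have n0 : 1 - polar (rad n) th != 0 by apply: subr_neq0_disc;
  rewrite normc_polar rad_lt1.
rewrite Im_mobius// divr_ge0 ?exprn_ge0 ?normc_ge0// mulr_ge0 ?(ltW be0)//.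
by rewrite subr_ge0 normc_polar ltW// expr_lt1.
Qed.

(* The difference of the integrands of the two mean values; it tends to 0 off
   N, so that no boundary function has to be integrated. *)
Let gap (c : R[i]) n th := Re (c * f (mobius al be (polar (rad n) th)))
   - Re (c^* * g (mobius al be (polar (rad n) th))).

Let gap_cvg c th : D th -> ~ N th -> gap c n th @[n --> \oo] --> (0 : R).
Proof.
move=> Dth Nth.
have tht : 0 < th < tau.
  have /andP[h0 ht] : 0 <= th <= tau by move: Dth; rewrite /D/= in_itv.
  have n0 : th != 0 by apply/eqP => e; apply: Nth; left; left.
  have nt : th != tau by apply/eqP => e; apply: Nth; left; right.
  by rewrite !lt_neqAle eq_sym n0 h0 nt ht.
have nZ : ~ Z (Re (mb th)) by move=> hZ; apply: Nth; right.
have zc : ccvg \oo (fun n => mobius al be (polar (rad n) th)) (mb th).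
  by apply: ccvg_mobius => //; exact: n1.
have mbr := mb_real tht; set x := Re (mb th) in mbr nZ.
have k1n : k1 x%:C != 0 by apply/eqP => h; apply: nZ; left; left; left.
have k2n : k2 x%:C != 0 by apply/eqP => h; apply: nZ; left; left; right.
have k3n : k3 x%:C != 0 by apply/eqP => h; apply: nZ; left; right.
have k4n : k4 x%:C != 0 by apply/eqP => h; apply: nZ; right.
rewrite mbr in zc; have x0 : 0 <= Im x%:C by exact: lexx.
have fc := sqrt_cayley_cvg e1 e2 (fun n => Im_ge0 n th) x0 zc k1n k2n.
have gc := sqrt_cayley_cvg e3 e4 (fun n => Im_ge0 n th) x0 zc k3n k4n.
have [h1 _] : ccvg \oo (fun n => c * f (mobius al be (polar (rad n) th))) (c *
  f x%:C).
  by apply: ccvgM => //; exact: ccvg_cst.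
have [h2 _] : ccvg \oo (fun n => c^* * g (mobius al be (polar (rad n) th)))
  (c^* * g x%:C).
  by apply: ccvgM => //; exact: ccvg_cst.
have -> : (0 : R) = Re (c * f x%:C) - Re (c^* * g x%:C).
  by rewrite boundary_conj// !(ReM, ReJ, ImJ); ring.
exact: cvgB.
Qed.

Let sqrt_cayley_bound (k dk k' dk' : R[i] -> R[i]) : halfplane_exponent k dk ->
  halfplane_exponent k' dk' ->
  forall z, 0 < Im z -> `|Re (sqrt_cayley k k' z)| <= 1 /\ `|Im (sqrt_cayley k
    k' z)| <= 1.
Proof.
move=> ke ke' z /ltW z0; have h := normc_sqrt_cayley ke ke' z0.
by split; [exact: le_trans (Re_le_normc _) h|exact: le_trans (Im_le_normc _) h].
Qed.

(** The identity of [boundary_conj] propagates inside: both members are means of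
their boundary values over the unit circle, by dominated convergence. *)
Lemma interior_conj : g (al +i* be) = (f (al +i* be))^*.
Proof.
suff key (c : R[i]) : Re (c * f (al +i* be)) = Re (c^* * g (al +i* be)).
  apply: complexP; rewrite ?ReJ ?ImJ.
  - by have := key 1; rewrite rmorph1 !mul1r.
  - by have := key 'i%C;
    rewrite !(ReM, ImM)/= !mul0r !sub0r mulN1r opprK !mul1r => <-.
have If (n : nat) := mean_value al be0 (holo_sqrt_cayley e1 e2)
  (sqrt_cayley_bound e1 e2) (dsqrt_cayley_bound e1 e2) c (rad01 n).
have Ig (n : nat) := mean_value al be0 (holo_sqrt_cayley e3 e4)
  (sqrt_cayley_bound e3 e4) (dsqrt_cayley_bound e3 e4) (c^*) (rad01 n).
have intf (n : nat) := integrable_circle al be0 (holo_sqrt_cayley e1 e2)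
  (sqrt_cayley_bound e1 e2) c (rad_lt1 n).
have intg (n : nat) := integrable_circle al be0 (holo_sqrt_cayley e3 e4)
  (sqrt_cayley_bound e3 e4) (c^*) (rad_lt1 n).
pose C : R := normc c + normc (c^*).
have Igap n : \int[lebesgue_measure]_(th in D) gap c n th =
    tau * (Re (c * f (al +i* be)) - Re (c^* * g (al +i* be))).
  by rewrite RintegralB// If Ig mulrBr.
have gapB n th : D th -> `|gap c n th| <= C.
  move=> _; rewrite (le_trans (ler_normB _ _))// lerD// (le_trans (Re_le_normc
    _))//.
    rewrite ComplexField.Normc.normcM ler_piMr ?normc_ge0//.
    exact: (normc_sqrt_cayley e1 e2 (Im_ge0 n th)).
  rewrite ComplexField.Normc.normcM ler_piMr ?normc_ge0//.
  exact: (normc_sqrt_cayley e3 e4 (Im_ge0 n th)).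
have cvgI : \int[lebesgue_measure]_(th in D) gap c n th @[n --> \oo] -->
    \int[lebesgue_measure]_(th in D) (cst 0 : R -> R) th.
  apply: (@cvg_Rintegral R _ _ lebesgue_measure D mD (gap c) (cst 0) (cst C)) => //.
  - move=> n; apply: measurable_funB.
    + by apply/measurable_EFinP; exact: measurable_int (intf n).
    + by apply/measurable_EFinP; exact: measurable_int (intg n).
  - exists N; split; first exact: countable_measurable.
    + exact: countable_lebesgue_measure0.
    + by move=> th /= /not_implyP[Dth ng]; apply: contrapT => Nth; apply: ng;
      exact: gap_cvg.
  - exact: integrable_cst_itv.
move: cvgI; rewrite Rintegral_cst// mul0r => cvgI.
have cst0 : tau * (Re (c * f (al +i* be)) - Re (c^* * g (al +i* be))) = 0.
  have cc : \int[lebesgue_measure]_(th in D) gap c n th @[n --> \oo] -->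
     tau * (Re (c * f (al +i* be)) - Re (c^* * g (al +i* be))).
    by under eq_fun do rewrite Igap; exact: cvg_cst.
  exact: (cvg_unique _ cc cvgI).
move/eqP: cst0; rewrite mulf_eq0 gt_eqF//= subr_eq0 => /eqP; exact.
Qed.

End at_point.


Let UHP_E (z : R[i]) : 0 < Im z -> g z = (f z)^*.
Proof. by case: z => a b b0; exact: interior_conj. Qed.

(* Both f and its conjugate g are holomorphic: moving horizontally gives
   g' = conj f', moving vertically gives i g' = conj (i f'). *)
Let dsqrt_cayley_eq0 (z : R[i]) : 0 < Im z -> dsqrt_cayley k1 dk1 k2 dk2 z = 0.
Proof.
case: z => a b /= b0.
have hf := holo_sqrt_cayley e1 e2; have hg := holo_sqrt_cayley e3 e4.
set df := dsqrt_cayley k1 dk1 k2 dk2 in hf *;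
  set dg := dsqrt_cayley k3 dk3 k4 dk4 in hg *.
have conj_der (c : R -> R[i]) v t0 t1 t : good_curve c v t0 t1 -> t0 < t < t1 ->
    dg (c t) * v t = (df (c t) * v t)^*.
  move=> cv tt.
  have c0 s : t0 < s < t1 -> 0 < Im (c s).
    by case: cv => _ [eta eta0 [M h]] /h[h' _ _]; exact: lt_le_trans h'.
  have [f1 f2] := holo_chain hf cv tt.
  apply: (cder_unique (holo_chain hg cv tt)).
  have fgE : \forall s \near t, ((f \o c) s)^* = (g \o c) s.
    have : t \in `]t0, t1[ by rewrite in_itv.
    move/near_in_itvoo; apply: filterS => s /=; rewrite in_itv/= => ss.
    by rewrite UHP_E// c0.
  apply: (cder_near_eq fgE); split.
  - rewrite ReJ;
    have -> : (fun s => Re (((f \o c) s)^*)) = (fun s => Re ((f \o c) s)).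
      by apply/funext => s; exact: ReJ.
    exact: f1.
  - rewrite ImJ;
    have -> : (fun s => Im (((f \o c) s)^*)) = (fun s => - Im ((f \o c) s)).
      by apply/funext => s; exact: ImJ.
    exact: derN.
have ch : good_curve (fun t => t +i* b) (fun=> 1) (a - 1) (a + 1).
  split; first by move=> t _; split; [exact: derid|exact: dercst].
  exists b => //; exists 1 => t _; rewrite /= lexx normr1 normr0; split => //.
have cv : good_curve (fun t => a +i* t) (fun=> 'i%C) (b / 2) (b + 1).
  split; first by move=> t _; split; [exact: dercst|exact: derid].
  exists (b / 2); first by rewrite divr_gt0.
  by exists 1 => t /andP[/ltW h _]; rewrite /= normr1 normr0; split.
have := conj_der _ _ _ _ a ch; have := conj_der _ _ _ _ b cv.
have -> : b / 2 < b < b + 1 by apply/andP; split; lra.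
have -> : a - 1 < a < a + 1 by apply/andP; split; lra.
move=> /(_ isT) + /(_ isT); move: (df (a +i* b)) (dg (a +i* b)) => p q hv hh.
have := congr1 (@complex.Re R) hv; have := congr1 (@complex.Im R) hv.
have := congr1 (@complex.Re R) hh; have := congr1 (@complex.Im R) hh.
rewrite !(ReM, ImM, ReJ, ImJ)/= => h1 h2 h3 h4.
by apply: complexP; [change (Re p = 0)|change (Im p = 0)]; lra.
Qed.

(** The vertical half-line is parametrized by expR, so that the curve is
defined on all of R. *)
Lemma sqrt_cayley_const (z : R[i]) : 0 < Im z -> f z = f 'i%C.
Proof.
case: z => a b /= b0; have hf := holo_sqrt_cayley e1 e2.
have der0 (c : R -> R[i]) v t0 t1 t : good_curve c v t0 t1 -> t0 < t < t1 ->
    cder (f \o c) t 0.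
  move=> cv tt; apply: (cder_eq (holo_chain hf cv tt)).
  rewrite dsqrt_cayley_eq0 ?mul0r//.
  by case: cv => _ [eta eta0 [M h]]; have [h' _ _] := h t tt; exact: lt_le_trans h'.
have cst (c : R -> R[i]) s t : (forall u, cder (f \o c) u 0) -> f (c s) = f (c t).
  move=> h; apply: complexP.
  - exact: (is_derive_0_is_cst s t (fun u => (h u).1)).
  - exact: (is_derive_0_is_cst s t (fun u => (h u).2)).
have itv1 (u : R) : u - 1 < u < u + 1 by apply/andP; split; lra.
have -> : f (a +i* b) = f (0 +i* b).
  apply: (cst (fun t => t +i* b)) => u.
  apply: (der0 _ (fun=> 1) _ _ _ _ (itv1 u)).
  split; first by move=> t _; split; [exact: derid|exact: dercst].
  by exists b => //; exists 1 => t _; rewrite /= lexx normr1 normr0.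
have -> : b = expR (ln b) by rewrite lnK.
have -> : 'i%C = 0 +i* expR 0 :> R[i] by rewrite expR0.
apply: (cst (fun t => 0 +i* expR t)) => u.
apply: (der0 _ (fun t => 0 +i* expR t) _ _ _ _ (itv1 u)).
split; first by move=> t _; split; [exact: dercst|exact: is_derive_expR].
exists (expR (u - 1)); first exact: expR_gt0.
exists (expR (u + 1)) => t /andP[h1 h2] /=.
rewrite normr0 expR_ge0 (ger0_norm (expR_ge0 _)) !ler_expR.
by split=> //; exact: ltW.
Qed.

(** Continuity up to the real line, along z + i / (n + 1). *)
Lemma proportional_closed (k dk k' dk' : R[i] -> R[i]) (c : R) :
  halfplane_exponent k dk -> halfplane_exponent k' dk' ->
  (forall z, 0 < Im z -> k z = c%:C * k' z) ->
  forall z, 0 <= Im z -> k z = c%:C * k' z.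
Proof.
move=> ke ke' h z z0.
pose u (n : nat) : R[i] := z + (0 +i* n.+1%:R^-1).
have un n : 0 < Im (u n) by rewrite /u ImD/= ltr_wpDl// invr_gt0.
have uz : ccvg \oo u z.
  rewrite -[z]addr0; apply: ccvgD; first exact: ccvg_cst.
  by split=> /=; [exact: cvg_cst|exact: cvg_harmonic].
have c1 := exp_cvg ke (fun n => ltW (un n)) uz.
have c3 := exp_cvg ke' (fun n => ltW (un n)) uz.
have c2 : ccvg \oo (k \o u) (c%:C * k' z).
  have -> : k \o u = fun n => c%:C * k' (u n) by apply/funext => n; exact: h.
  by apply: ccvgM; [exact: ccvg_cst|exact: c3].
apply: complexP.
- exact: (cvg_unique _ c1.1 c2.1).
- exact: (cvg_unique _ c1.2 c2.2).
Qed.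

(** On the imaginary axis exponents are real, so the constant value of f is
cayley S T with S and T positive; then f = conj g = cayley S T says that
sqrt k1 / sqrt k2 and sqrt k3 / sqrt k4 are both equal to S / T. *)
Lemma factorization_unique : exists c : R, 0 < c /\
  forall z, 0 <= Im z -> k1 z = c%:C * k2 z /\ k3 z = c%:C * k4 z.
Proof.
have i0 : 0 < Im 'i%C :> R by rewrite /= ltr01.
have real_i (k dk : R[i] -> R[i]) : halfplane_exponent k dk -> exists2 s : R, 0
  < s & csqrt (k 'i%C) = s%:C.
  move=> ke; have k0 := Re_halfplane_exponent_gt0 ke i0.
  have Ik : Im (k 'i%C) = 0 by exact: (exp_imag ke 1).
  have kn0 : k 'i%C != 0 by apply/eqP => e; move: k0; rewrite e ltxx.
  exists (Re (csqrt (k 'i%C))); last by apply: complexP => //=; rewrite Ik mul0r.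
  rewrite lt_neqAle Re_csqrt_ge0 andbT eq_sym; apply/eqP => r0.
  have := csqrt_sector (ltW k0); rewrite r0 normr_le0 => /eqP j0.
  have : csqrt (k 'i%C) == 0 by apply/eqP/complexP.
  by rewrite csqrt_eq0 ?(negbTE kn0)// ltW.
have [S S0 SE] := real_i _ _ e1; have [T T0 TE] := real_i _ _ e2.
have sum_neq0 (k dk k' dk' : R[i] -> R[i]) (z : R[i]) : halfplane_exponent k dk
  -> halfplane_exponent k' dk' -> 0 < Im z ->
    csqrt (k z) + csqrt (k' z) != 0.
  move=> ke ke' z0; have h := Re_halfplane_exponent_gt0 ke z0;
    have h' := Re_halfplane_exponent_gt0 ke' z0.
  apply: csqrt_sum_neq0; [exact: ltW|exact: ltW|].
  by apply/eqP => e; move: h; rewrite e ltxx.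
have ST : S%:C + T%:C != 0 :> R[i] by rewrite -SE -TE; exact: sum_neq0 e1 e2 i0.
have fi : f 'i%C = cayley S%:C T%:C by rewrite /f /sqrt_cayley SE TE.
have Sn : S%:C != 0 :> R[i] by rewrite -[0]/(0%:C) (inj_eq (@complexI R)) gt_eqF.
have Tn : T%:C != 0 :> R[i] by rewrite -[0]/(0%:C) (inj_eq (@complexI R)) gt_eqF.
have sq (k k' dk dk' : R[i] -> R[i]) (z : R[i]) : halfplane_exponent k dk ->
  halfplane_exponent k' dk' -> 0 < Im z ->
    csqrt (k z) * T%:C = csqrt (k' z) * S%:C -> k z = ((S / T) ^+ 2)%:C * k' z.
  move=> ke ke' z0 e; have h := Re_halfplane_exponent_gt0 ke z0;
    have h' := Re_halfplane_exponent_gt0 ke' z0.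
  rewrite -(csqrtK (ltW h)) -(csqrtK (ltW h')).
  rewrite rmorphXn/= -exprMn; congr (_ ^+ 2).
  rewrite fmorph_div/=; apply: (mulIf Tn); rewrite e; by field.
exists ((S / T) ^+ 2); split; first by rewrite exprn_gt0// divr_gt0.
move=> z z0; split.
- apply: (proportional_closed e1 e2) z0 => {}z z0; apply: (sq _ _ _ _ _ e1 e2 z0).
  by apply: (proj1 (cayley_eqP (sum_neq0 _ _ _ _ _ e1 e2 z0) ST));
    rewrite -fi -(sqrt_cayley_const z0).
- apply: (proportional_closed e3 e4) z0 => {}z z0; apply: (sq _ _ _ _ _ e3 e4 z0).
  apply: (proj1 (cayley_eqP (sum_neq0 _ _ _ _ _ e3 e4 z0) ST)).
  rewrite -/(sqrt_cayley k3 k4 z) -/(g z) UHP_E// sqrt_cayley_const// fi.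
  apply: complexP;
    rewrite ?(ReJ, ImJ)// /cayley !(ReM, ImM, ReV, ImV, ReD, ImD, ReN, ImN)/=; ring.
Qed.

End factorization_unique.

Theorem theorem1 (R : realType) (d : measure_display)
    (Omega : measurableType d) (P : probability Omega R)
    (X : R -> {RV P >-> R}) (psi : R -> R[i])
    (hX : levy_process X) (hpsi : is_levy_exponent X psi)
    (* equivalently, X is not the zero process *)
    (hX0 : exists z : R, psi z <> 0)
    (kp km kp' km' : R[i] -> R[i])
    (hkp : is_subordinator_exponent kp) (hkm : is_subordinator_exponent km)
    (hkp' : is_subordinator_exponent kp') (hkm' : is_subordinator_exponent km')
    (hfact : forall z : R, psi z = kp z%:C * km (- z%:C))
    (hfact' : forall z : R, psi z = kp' z%:C * km' (- z%:C)) :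
  exists c : R, 0 < c /\
    forall z : R[i], 0 <= complex.Im z -> kp z = c%:C * kp' z /\ km' z = c%:C * km z.
Proof.
have [x /eqP px] := hX0.
have Nx : - x%:C = (- x)%:C by rewrite rmorphN.
have [n1 n4] : kp x%:C != 0 /\ km (- x)%:C != 0.
  by apply/andP; rewrite -Nx -negb_or -mulf_eq0 -hfact.
have [n2 n3] : kp' x%:C != 0 /\ km' (- x)%:C != 0.
  by apply/andP; rewrite -Nx -negb_or -mulf_eq0 -hfact'.
have [k1 [dk1 [e1 E1]]] := halfplane_exponent_of_subordinator hkp (ex_intro _ x n1).
have [k2 [dk2 [e2 E2]]] := halfplane_exponent_of_subordinator hkp' (ex_intro _ x n2).
have [k3 [dk3 [e3 E3]]] := halfplane_exponent_of_subordinator hkm' (ex_intro _ (- x) n3).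
have [k4 [dk4 [e4 E4]]] := halfplane_exponent_of_subordinator hkm (ex_intro _ (- x) n4).
have r0 (y : R) : 0 <= complex.Im y%:C by exact: lexx.
have rN (y : R) : 0 <= complex.Im (- y%:C) by rewrite ImN/= oppr0.
have psiE y : psi y = k1 y%:C * k4 (- y%:C) by rewrite hfact E1// E4.
have psiE' y : psi y = k2 y%:C * k3 (- y%:C) by rewrite hfact' E2// E3.
have Re_ge0 y : 0 <= complex.Re (k1 y%:C * k4 (- y%:C)).
  by rewrite -psiE; exact: Re_levy_exponent_ge0 hpsi.
have fact y : k1 y%:C * k4 (- y%:C) = k2 y%:C * k3 (- y%:C).
  by rewrite -psiE psiE'.
have [c [c0 hc]] := factorization_unique e1 e2 e3 e4 Re_ge0 fact.
by exists c; split=> // z z0; rewrite E1// E2// E3// E4//; exact: hc.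
Qed.
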